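(* Let $K$ be a positive integer, let $p\in\mathbb{Z}$ with $p\neq 0$, and set $q=2K(2pK+1)$. Then \[ \psi\left(\sqrt{p/q}\right)=\frac{2}{3}+\frac{p}{K}-\frac{p}{q}, \] where $\psi$ is the secant zeta function $\psi(r)=\frac{4}{\pi^2}\sum_{n\ge 1}\frac{\sec(n\pi r)}{n^2}$.
   Context: The secant zeta function is $\psi(r)=\frac{4}{\pi^2}\sum_{n\ge1}\frac{\sec(n\pi r)}{n^2}$ (with $\sec x=1/\cos x$); it is even and $2$-periodic in $r$. Note that $p/q>0$ for every admissible $p$ and $K$ (when $p<0$, $q<0$ as well), so $\sqrt{p/q}$ is a positive real number. *)

(* Defs.v *)
From Stdlib Require Import Reals ZArith.
From Coquelicot Require Import Coquelicot.
Open Scope R_scope.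

Definition sec (x : R) : R := / cos x.

(* n-th term (indexed from 0, i.e. n+1 >= 1) of the secant zeta series
   psi(r) = 4/pi^2 * sum_{n>=1} sec(n pi r) / n^2 *)
Definition secant_zeta_term (r : R) (n : nat) : R :=
  4 / PI ^ 2 * (sec (INR (S n) * PI * r) / INR (S n) ^ 2).

Definition secant_zeta_is (r v : R) : Prop :=
  is_series (secant_zeta_term r) v.

(* Main.v *)
Require Import Defs.
From Stdlib Require Import Reals ZArith Lra Lia List.
From Coquelicot Require Import Coquelicot.
Open Scope R_scope.

(** For [psi] at [rho], the function [f x = 1/(2 pi^2) sum_n cos (2 pi n x) sec (pi n rho) / n^2]
    has [f 0 = psi rho / 8], is 1-periodic, and satisfies
    [f (x + rho/2) + f (x - rho/2) = x^2 - |x| + 1/6] on [[-1, 1]] (the Fourier series of the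
    second Bernoulli polynomial).  Rescaling gives analogous solutions of period [om] and
    step [s].  If two solutions have the same step [s] and periods [1] and [1 + 2 K s], the
    kinks of their right-hand sides at [0] cancel, so their difference minus an explicit
    quadratic polynomial is, near [0], 1-periodic and [s]-antiperiodic; as [s] is irrational and
    the solutions are continuous, it vanishes at [0].  This yields
    [(1 + 2 K s) psi (s / (1 + 2 K s)) - psi s = 4 K s / 3 + 2 K s^3 / (1 + 2 K s)].

    For [r = sqrt (p / q)] one has [r / (1 - 2 K r) = r / (1 + 2 K r) + 2 p], and [psi] is even
    and 2-periodic, so the functional equations at [r] and at [r / (1 - 2 K r)] form a linear
    system for [psi r].  When [p < 0] the second point is negative and a variant with period
    [2 K s - 1] is used.

    Absolute convergence holds because [r] is badly approximable: the fractional parts of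
    [n r + 1/2], [n <= N], are [c / N]-separated, so [sum_(n <= N) sec^2 (pi n r) = O (N^2)]. *)

(** * Irrational rotations *)

(** Phrased as the absence of integer relations, so that elements of the group [Z w + Z] can be
    tested for zero directly. *)
Definition irrational (w : R) : Prop :=
  forall a b : Z, a <> 0%Z -> IZR a * w + IZR b <> 0.

Lemma Int_part_bounds (x : R) : IZR (Int_part x) <= x < IZR (Int_part x) + 1.
Proof. destruct (base_Int_part x); lra. Qed.

Lemma irrational_affine (w : R) (a b : Z) :
  a <> 0%Z -> irrational w -> irrational (IZR a * w + IZR b).
Proof.
  intros Ha Hw c d Hc.
  replace (IZR c * (IZR a * w + IZR b) + IZR d)
    with (IZR (c * a) * w + IZR (c * b + d)).
  - apply Hw; lia.
  - rewrite plus_IZR, !mult_IZR; ring.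
Qed.

(* If [g] lies in the group [Z w + Z], so do [1 mod g] and its complement in [g]; the smaller
   one is at most [g / 2]. *)
Lemma irrational_small_combination (w : R) (n : nat) :
  irrational w ->
  exists a b : Z, a <> 0%Z /\ 0 < IZR a * w + IZR b <= / 2 ^ n.
Proof.
  intros Hw; induction n as [|n IH].
  - exists 1%Z, (- Int_part w)%Z.
    assert (H1 := Int_part_bounds w).
    assert (H2 := Hw 1%Z (- Int_part w)%Z ltac:(lia)).
    rewrite opp_IZR in *; split; [lia|]. simpl; lra.
  - destruct IH as (a & b & Ha & Hg0 & Hg).
    set (g := IZR a * w + IZR b) in *.
    assert (Hle1 : g <= 1).
    { apply Rle_trans with (1 := Hg). rewrite <- Rinv_1.
      apply Rinv_le_contravar; [lra|]. apply pow_R1_Rle; lra. }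
    assert (Hf := Int_part_bounds (/ g)).
    set (k := Int_part (/ g)) in *.
    assert (Hk : (1 <= k)%Z).
    { assert (Hinv : 1 <= / g) by (rewrite <- Rinv_1; apply Rinv_le_contravar; lra).
      assert (0 < k)%Z by (apply lt_IZR; lra). lia. }
    assert (Hinvg : / g * g = 1) by (field; lra).
    assert (Hx : 0 <= 1 - IZR k * g < g) by (split; nra).
    assert (Hx0 : 1 - IZR k * g <> 0).
    { replace (1 - IZR k * g) with (IZR (- k * a) * w + IZR (1 - k * b)).
      - apply Hw; nia.
      - unfold g; rewrite minus_IZR, !mult_IZR, opp_IZR; ring. }
    assert (Hpow : / 2 ^ S n = / 2 ^ n / 2)
      by (simpl; field; apply pow_nonzero; lra).
    destruct (Rle_dec (1 - IZR k * g) (g / 2)) as [Hs|Hs].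
    + exists (- k * a)%Z, (1 - k * b)%Z; split; [nia|].
      replace (IZR (- k * a) * w + IZR (1 - k * b)) with (1 - IZR k * g)
        by (unfold g; rewrite minus_IZR, !mult_IZR, opp_IZR; ring).
      rewrite Hpow; lra.
    + exists (a + k * a)%Z, (b + k * b - 1)%Z; split; [nia|].
      replace (IZR (a + k * a) * w + IZR (b + k * b - 1)) with (g - (1 - IZR k * g))
        by (unfold g; rewrite minus_IZR, !plus_IZR, !mult_IZR; ring).
      rewrite Hpow; lra.
Qed.

(** Subtracting from [w] a multiple of a small element of [Z (2 w) + Z] keeps the coefficient of [w]
    odd and leaves a remainder below that element. *)
Lemma irrational_odd_approx (w d : R) :
  irrational w -> 0 < d ->
  exists (n : nat) (m : Z), Rabs (INR (2 * n + 1) * w - IZR m) < d.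
Proof.
  intros Hw Hd.
  assert (H2w : irrational (2 * w)).
  { replace (2 * w) with (IZR 2 * w + IZR 0) by ring.
    apply irrational_affine; [lia|exact Hw]. }
  assert (Hn : exists n, / 2 ^ n < d).
  { destruct (pow_lt_1_zero (/ 2) ltac:(rewrite Rabs_pos_eq; lra) d Hd) as [n Hn].
    exists n. specialize (Hn n (le_n n)).
    rewrite <- pow_inv. apply Rle_lt_trans with (2 := Hn); apply Rle_abs. }
  destruct Hn as [n Hn].
  destruct (irrational_small_combination (2 * w) n H2w) as (a & b & Ha & Hg0 & Hg).
  set (g := IZR a * (2 * w) + IZR b) in *.
  assert (Hf := Int_part_bounds (w / g)).
  set (k := Int_part (w / g)) in *.
  assert (Hwg : w / g * g = w) by (field; lra).
  assert (Hrem : Rabs (IZR (1 - 2 * k * a) * w - IZR (k * b)) < d).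
  { replace (IZR (1 - 2 * k * a) * w - IZR (k * b)) with (w - IZR k * g)
      by (unfold g; rewrite minus_IZR, !mult_IZR; ring).
    rewrite Rabs_pos_eq; nra. }
  (* The odd coefficient [1 - 2 k a] may be negative; then the opposite combination is used. *)
  destruct (Z_le_gt_dec 0 (- (k * a))) as [Hs|Hs].
  - exists (Z.to_nat (- (k * a))), (k * b)%Z.
    rewrite INR_IZR_INZ.
    replace (Z.of_nat (2 * Z.to_nat (- (k * a)) + 1)) with (1 - 2 * k * a)%Z by lia.
    exact Hrem.
  - exists (Z.to_nat (k * a - 1)), (- (k * b))%Z.
    rewrite INR_IZR_INZ.
    replace (Z.of_nat (2 * Z.to_nat (k * a - 1) + 1)) with (- (1 - 2 * k * a))%Z by lia.
    rewrite !opp_IZR, <- Rabs_Ropp.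
    match goal with |- Rabs ?t < _ =>
      replace t with (IZR (1 - 2 * k * a) * w - IZR (k * b)) by ring end.
    exact Hrem.
Qed.

(* The orbit of [0] under the rotation by [w] modulo 1 can be followed inside an interval of
   length [1 + w], and odd iterates come back arbitrarily close to [0]. *)
Lemma locally_antiperiodic_zero (w : R) (E : R -> R) :
  0 < w -> irrational w ->
  let h := (1 + w) / 2 in
  (forall x, - h <= x -> x + 1 <= h -> E (x + 1) = E x) ->
  (forall x, - h <= x -> x + w <= h -> E (x + w) = - E x) ->
  continuity_pt E 0 -> E 0 = 0.
Proof.
  intros Hw0 Hirr h HE1 HEw HEc.
  assert (Hnat : forall (j : nat) x, - h <= x -> x + INR j <= h -> E (x + INR j) = E x).
  { induction j as [|j IH]; intros x H1 H2.
    - simpl; f_equal; ring.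
    - rewrite S_INR in *. rewrite <- Rplus_assoc in *.
      rewrite HE1; [apply IH; lra| |lra].
      assert (H := pos_INR j); lra. }
  assert (Hint : forall x y (m : Z), - h <= x <= h -> - h <= y <= h -> x = y + IZR m ->
            E x = E y).
  { intros x y m Hx Hy Hxy.
    destruct (Z_le_gt_dec 0 m) as [Hm|Hm].
    - rewrite <- (Z2Nat.id m Hm), <- INR_IZR_INZ in Hxy.
      subst x; apply Hnat; lra.
    - assert (Hyx : y = x + INR (Z.to_nat (- m))).
      { rewrite INR_IZR_INZ, Z2Nat.id, opp_IZR by lia; lra. }
      rewrite Hyx; symmetry; apply Hnat; lra. }
  (* Reducing [y] modulo 1 into [[-h, 1 - h)] leaves room for one step, since [1 - h + w = h]. *)
  assert (Hstep : forall y, - h <= y <= h ->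
            exists y' (m : Z), - h <= y' <= h /\ y' = y + w + IZR m /\ E y' = - E y).
  { intros y Hy.
    assert (Hf := Int_part_bounds (y + h)).
    set (j := Int_part (y + h)) in *.
    assert (Hr : - h <= y - IZR j <= h) by (unfold h in *; lra).
    exists (y - IZR j + w), (- j)%Z.
    split; [unfold h in *; lra|]. split; [rewrite opp_IZR; ring|].
    rewrite HEw by (unfold h in *; lra).
    rewrite (Hint (y - IZR j) y (- j)%Z Hr Hy); [reflexivity|].
    rewrite opp_IZR; ring. }
  assert (Hiter : forall n : nat,
            exists y (m : Z), - h <= y <= h /\ y = INR n * w + IZR m /\ E y = (- 1) ^ n * E 0).
  { induction n as [|n (y & m & Hy & Hyn & HEy)].
    - exists 0, 0%Z. unfold h; simpl; repeat split; lra.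
    - destruct (Hstep y Hy) as (y' & m' & Hy' & Hy'y & HEy').
      exists y', (m + m')%Z. split; [exact Hy'|]. split.
      + rewrite Hy'y, Hyn, S_INR, plus_IZR; ring.
      + rewrite HEy', HEy; simpl; ring. }
  (* An odd return [x] near 0 has [E x = - E 0], at distance [2 |E 0|] from [E 0], against
     continuity. *)
  destruct (Req_dec (E 0) 0) as [H0|H0]; [exact H0|exfalso].
  assert (Hpos : 0 < Rabs (E 0)) by (apply Rabs_pos_lt; exact H0).
  destruct (proj1 (continuity_pt_locally E 0) HEc (mkposreal _ Hpos)) as [d Hd].
  assert (Hdh : 0 < Rmin d h) by (apply Rmin_pos; [apply cond_pos|unfold h; lra]).
  destruct (irrational_odd_approx w (Rmin d h) Hirr Hdh) as (n & m & Hnm).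
  set (x := INR (2 * n + 1) * w - IZR m) in *.
  assert (Hxd : Rabs x < d) by (apply Rlt_le_trans with (1 := Hnm), Rmin_l).
  assert (Hxh : Rabs x < h) by (apply Rlt_le_trans with (1 := Hnm), Rmin_r).
  apply Rabs_def2 in Hxh.
  destruct (Hiter (2 * n + 1)%nat) as (y & m' & Hy & Hyn & HEy).
  assert (HEx : E x = - E 0).
  { rewrite (Hint x y (- m - m')%Z).
    - rewrite HEy, pow_add, pow_1, pow_1_even; ring.
    - lra.
    - exact Hy.
    - unfold x; rewrite Hyn, minus_IZR, opp_IZR; ring. }
  assert (Hc : Rabs (E x - E 0) < Rabs (E 0)).
  { apply (Hd x). unfold ball; simpl; unfold AbsRing_ball, abs, minus, plus, opp; simpl.
    rewrite Ropp_0, Rplus_0_r; exact Hxd. }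
  rewrite HEx in Hc.
  replace (- E 0 - E 0) with (- (2 * E 0)) in Hc by ring.
  rewrite Rabs_Ropp, Rabs_mult, (Rabs_pos_eq 2) in Hc by lra. lra.
Qed.

(** * Functional equations *)

(* The right-hand side extends [om]-periodically, but only [-om <= x <= om] is needed. *)
Record secant_solution (om s : R) (f : R -> R) : Prop := {
  solution_periodic : forall x, f (x + om) = f x;
  solution_equation : forall x, Rabs x <= om ->
    f (x + s / 2) + f (x - s / 2) = x ^ 2 / om - Rabs x + om / 6;
  solution_continuous : continuity_pt f 0
}.

(** The outer factor [l] keeps the kink term [- Rabs x] the same for every period; this is why kinks
    of solutions with different periods can cancel. *)
Lemma solution_scale (s l : R) (f : R -> R) :
  0 < l -> secant_solution 1 s f ->
  secant_solution l (l * s) (fun x => l * f (x / l)).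
Proof.
  intros Hl [Hp He Hc]; split.
  - intros x. replace ((x + l) / l) with (x / l + 1) by (field; lra).
    rewrite Hp; reflexivity.
  - intros x Hx.
    replace ((x + l * s / 2) / l) with (x / l + s / 2) by (field; lra).
    replace ((x - l * s / 2) / l) with (x / l - s / 2) by (field; lra).
    rewrite <- Rmult_plus_distr_l, He.
    + unfold Rdiv at 3. rewrite Rabs_mult, (Rabs_pos_eq (/ l)).
      * field; lra.
      * left; apply Rinv_0_lt_compat; lra.
    + unfold Rdiv. rewrite Rabs_mult, (Rabs_pos_eq (/ l)).
      * apply Rmult_le_reg_r with l; [lra|]. rewrite Rmult_assoc, Rinv_l; lra.
      * left; apply Rinv_0_lt_compat; lra.
  - apply continuity_pt_mult.
    + apply continuity_pt_const; intros ? ?; reflexivity.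
    + apply (continuity_pt_comp (fun x => x / l) f).
      * apply derivable_continuous_pt. exists (/ l).
        apply is_derive_Reals. auto_derive; [lra|field; lra].
      * replace (0 / l) with 0 by (field; lra). exact Hc.
Qed.

(** The half step moves by the integer [p], invisible to a 1-periodic function. This plays the part
    of the 2-periodicity of psi. *)
Lemma solution_shift (s : R) (f : R -> R) (p : Z) :
  secant_solution 1 s f -> secant_solution 1 (s + 2 * IZR p) f.
Proof.
  intros [Hp He Hc]; split; [exact Hp| |exact Hc].
  assert (Hnat : forall (n : nat) x, f (x + INR n) = f x).
  { induction n as [|n IH]; intros x.
    - simpl; f_equal; ring.
    - rewrite S_INR, <- Rplus_assoc, Hp; apply IH. }
  assert (HZ : forall x, f (x + IZR p) = f x).
  { intros x. destruct (Z_le_gt_dec 0 p) as [H|H].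
    - rewrite <- (Z2Nat.id p H), <- INR_IZR_INZ; apply Hnat.
    - rewrite <- (Hnat (Z.to_nat (- p)) (x + IZR p)).
      rewrite INR_IZR_INZ, Z2Nat.id, opp_IZR by lia. f_equal; ring. }
  intros x Hx. rewrite <- He by exact Hx.
  rewrite <- (HZ (x + s / 2)), <- (HZ (x - (s + 2 * IZR p) / 2)).
  f_equal; f_equal; field.
Qed.

Lemma solution_opp (s : R) (f : R -> R) :
  secant_solution 1 s f -> secant_solution 1 (- s) f.
Proof.
  intros [Hp He Hc]; split; [exact Hp| |exact Hc].
  intros x Hx. rewrite <- He by exact Hx. rewrite Rplus_comm.
  f_equal; f_equal; field.
Qed.

(* The polynomial solution of [Q (x + s/2) + Q (x - s/2) = x^2/om - x + om/6], the right-hand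
   side of the equation on the single period [0, om]. *)
Definition polynomial_solution (om s x : R) : R :=
  x ^ 2 / (2 * om) - x / 2 + (om / 12 - s ^ 2 / (8 * om)).

(** While the midpoint of a step lies in [[0, om]], [Rabs] is the identity there, so the difference
    changes sign over the step. The two bounds on [x] keep the first and the last midpoint in that
    interval. *)
Lemma solution_minus_polynomial (om s : R) (f : R -> R) :
  0 < om -> 0 < s -> secant_solution om s f ->
  forall (n : nat) x, - (s / 2) <= x -> x + INR n * s <= om + s / 2 ->
  f (x + INR n * s) - polynomial_solution om s (x + INR n * s)
  = (- 1) ^ n * (f x - polynomial_solution om s x).
Proof.
  intros Hom Hs [Hp He Hc]; induction n as [|n IH]; intros x H1 H2.
  - simpl; rewrite Rmult_0_l, Rplus_0_r; ring.
  - rewrite S_INR in *.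
    assert (Hn := pos_INR n).
    assert (Hns : 0 <= INR n * s) by nra.
    specialize (IH x H1 ltac:(lra)).
    set (y := x + INR n * s) in *.
    replace (x + (INR n + 1) * s) with (y + s) in * by (unfold y; ring).
    assert (Heq := He (y + s / 2)).
    rewrite Rabs_pos_eq in Heq by (unfold y; lra).
    specialize (Heq ltac:(lra)).
    replace (y + s / 2 + s / 2) with (y + s) in Heq by field.
    replace (y + s / 2 - s / 2) with y in Heq by ring.
    simpl pow. rewrite Rmult_assoc, <- IH.
    replace (f (y + s)) with ((y + s / 2) ^ 2 / om - (y + s / 2) + om / 6 - f y) by lra.
    unfold polynomial_solution; field; lra.
Qed.

Lemma functional_equation_add (K : nat) (r : R) (f g : R -> R) :
  (0 < K)%nat -> 0 < r -> irrational r ->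
  let om := 1 + 2 * INR K * r in
  secant_solution 1 r f -> secant_solution om r g ->
  g 0 - f 0 = INR K * r / 6 + INR K * r ^ 3 / (4 * om).
Proof.
  intros HK Hr Hirr om Hf Hg.
  assert (HK1 : 1 <= INR K) by (apply (le_INR 1); lia).
  assert (Hom : 1 < om) by (unfold om; nra).
  (* [al] is forced by 1-periodicity of the corrected difference, and [be] then by antiperiodicity
     in the step [r]. *)
  set (al := - (INR K * r / om)).
  set (be := INR K * r / 6 + INR K * r ^ 3 / (4 * om)).
  assert (HE : g 0 - f 0 - (al * 0 ^ 2 + be) = 0).
  { apply (locally_antiperiodic_zero r (fun x => g x - f x - (al * x ^ 2 + be))); [exact Hr|exact Hirr| | |].
    - intros x H1 H2.
      rewrite (solution_periodic _ _ _ Hf).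
      (* An even number [2 K] of steps leads from [x + 1] to [x + om], which is [x] modulo the
         period of [g]. *)
      assert (Hq := solution_minus_polynomial om r g ltac:(lra) Hr Hg (2 * K) (x + 1)).
      rewrite pow_1_even, mult_INR in Hq.
      replace (x + 1 + INR 2 * INR K * r) with (x + om) in Hq by (unfold om; simpl; ring).
      rewrite (solution_periodic _ _ _ Hg) in Hq.
      specialize (Hq ltac:(lra) ltac:(lra)).
      replace (g (x + 1)) with (g x - polynomial_solution om r (x + om)
                                + polynomial_solution om r (x + 1)) by lra.
      unfold polynomial_solution, al.
      assert (Hr2 : INR K * r = (om - 1) / 2) by (unfold om; field).
      rewrite Hr2. field; lra.
    - intros x H1 H2.
      assert (Habs : Rabs (x + r / 2) <= 1) by (apply Rabs_le; lra).
      assert (Hef := solution_equation _ _ _ Hf (x + r / 2) Habs).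
      assert (Heg := solution_equation _ _ _ Hg (x + r / 2) ltac:(lra)).
      replace (x + r / 2 + r / 2) with (x + r) in * by field.
      replace (x + r / 2 - r / 2) with x in * by ring.
      (* The same kink term occurs in both equations and drops out of [g - f]. *)
      set (a := Rabs (x + r / 2)) in *.
      replace (f (x + r)) with ((x + r / 2) ^ 2 / 1 - a + 1 / 6 - f x) by lra.
      replace (g (x + r)) with ((x + r / 2) ^ 2 / om - a + om / 6 - g x) by lra.
      unfold al, be, om in *. field. lra.
    - apply continuity_pt_minus.
      + apply continuity_pt_minus; [apply Hg|apply Hf].
      + apply derivable_continuous_pt. exists 0.
        apply is_derive_Reals. auto_derive; [exact I|ring]. }
  lra.
Qed.

(* Here the kinks of the two right-hand sides add up at [0], so the step used is [v - 1]
   instead of [v]: it centres the quadratic pieces at half periods. *)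
Lemma functional_equation_sub (K : nat) (v : R) (f g : R -> R) :
  (0 < K)%nat -> 1 < v -> irrational v ->
  let om := 2 * INR K * v - 1 in
  secant_solution 1 v f -> secant_solution om v g ->
  f 0 + g 0 = INR K * v / 6 - INR K * v ^ 3 / (4 * om).
Proof.
  intros HK Hv Hirr om Hf Hg.
  assert (HK1 : 1 <= INR K) by (apply (le_INR 1); lia).
  assert (Hom : 1 < om) by (unfold om; nra).
  set (al := INR K * v / om).
  set (be := INR K * v / 6 - INR K * v ^ 3 / (4 * om)).
  assert (Hr2 : INR K * v = (om + 1) / 2) by (unfold om; field).
  assert (HE : f 0 + g 0 - (al * 0 ^ 2 + be) = 0).
  { apply (locally_antiperiodic_zero (v - 1) (fun x => f x + g x - (al * x ^ 2 + be))); [lra| | | |].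
    - replace (v - 1) with (IZR 1 * v + IZR (-1)) by ring.
      apply irrational_affine; [lia|exact Hirr].
    - intros x H1 H2.
      rewrite (solution_periodic _ _ _ Hf).
      (* Here [2 K] steps lead from [x] to [x + 1 + om]. *)
      assert (Hq := solution_minus_polynomial om v g ltac:(lra) ltac:(lra) Hg (2 * K) x).
      rewrite pow_1_even, mult_INR in Hq.
      replace (x + INR 2 * INR K * v) with (x + 1 + om) in Hq by (unfold om; simpl; ring).
      rewrite (solution_periodic _ _ _ Hg) in Hq.
      specialize (Hq ltac:(lra) ltac:(lra)).
      replace (g (x + 1)) with (g x - polynomial_solution om v x
                                + polynomial_solution om v (x + 1 + om)) by lra.
      unfold polynomial_solution, al.
      rewrite Hr2. field; lra.
    - intros x H1 H2.
      (* For the step [v - 1] the window is [[-v/2, v/2]], so this midpoint never crosses the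
         kink. *)
      assert (Habs : Rabs (x + v / 2) = x + v / 2) by (apply Rabs_pos_eq; lra).
      assert (Hef := solution_equation _ _ _ Hf (x + v / 2)).
      rewrite Habs in Hef. specialize (Hef ltac:(lra)).
      replace (x + v / 2 + v / 2) with (x + (v - 1) + 1) in Hef by field.
      rewrite (solution_periodic _ _ _ Hf) in Hef.
      replace (x + v / 2 - v / 2) with x in Hef by ring.
      set (y := x + (v - 1)) in *.
      (* From [y = x + v - 1], an odd number [2 K - 1] of steps reaches [x + om]; the odd parity
         supplies the sign change. *)
      assert (Hq := solution_minus_polynomial om v g ltac:(lra) ltac:(lra) Hg (2 * K - 1) y).
      assert (Hodd : (- 1) ^ (2 * K - 1) = - 1).
      { replace (2 * K - 1)%nat with (S (2 * (K - 1))) by lia. apply pow_1_odd. }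
      rewrite Hodd, minus_INR, mult_INR in Hq by lia.
      replace (y + (INR 2 * INR K - INR 1) * v) with (x + om) in Hq
        by (unfold om, y; simpl; ring).
      rewrite (solution_periodic _ _ _ Hg) in Hq.
      specialize (Hq ltac:(unfold y; lra) ltac:(unfold y in H2; lra)).
      replace (f y) with ((x + v / 2) ^ 2 / 1 - (x + v / 2) + 1 / 6 - f x) by lra.
      replace (g y) with (polynomial_solution om v y
                          + polynomial_solution om v (x + om) - g x) by lra.
      unfold polynomial_solution, al, be, y.
      replace (INR K * v ^ 3) with ((INR K * v) * v ^ 2) by ring.
      rewrite Hr2. field; lra.
    - apply continuity_pt_minus.
      + apply continuity_pt_plus; [apply Hf|apply Hg].
      + apply derivable_continuous_pt. exists 0.
        apply is_derive_Reals. auto_derive; [exact I|ring]. }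
  lra.
Qed.

(** * The Fourier series of the second Bernoulli polynomial *)

(** Sums over [k < n], so that the empty sum is available; [sum_n] has one more term. *)
Fixpoint psum (f : nat -> R) (n : nat) : R :=
  match n with O => 0 | S k => psum f k + f k end.

Lemma sum_n_psum (f : nat -> R) (n : nat) : sum_n f n = psum f (S n).
Proof.
  induction n as [|n IH].
  - rewrite sum_O; simpl; ring.
  - rewrite sum_Sn, IH; reflexivity.
Qed.

Lemma is_lim_seq_psum (f : nat -> R) (l : R) :
  is_series f l -> is_lim_seq (psum f) l.
Proof.
  intros H. apply is_lim_seq_incr_1.
  apply is_lim_seq_ext with (2 := H). intros n; apply sum_n_psum.
Qed.

Lemma is_derive_psum (F F' : nat -> R -> R) (x : R) (n : nat) :
  (forall k, is_derive (F k) x (F' k x)) ->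
  is_derive (fun y => psum (fun k => F k y) n) x (psum (fun k => F' k x) n).
Proof.
  intros H; induction n as [|n IH]; simpl.
  - apply (is_derive_const 0).
  - apply (is_derive_plus (fun y => psum (fun k => F k y) n) (F n)); [exact IH|apply H].
Qed.

Definition cosine_series (a : nat -> R) (x : R) : R :=
  Series (fun n => a n * cos (2 * PI * INR (S n) * x)).

Lemma Rabs_mult_cos_le (a x : R) : Rabs (a * cos x) <= Rabs a.
Proof.
  rewrite Rabs_mult. rewrite <- (Rmult_1_r (Rabs a)) at 2.
  apply Rmult_le_compat_l; [apply Rabs_pos|].
  apply Rabs_le. assert (H := COS_bound x); lra.
Qed.

Lemma ex_series_cosine (a : nat -> R) (x : R) :
  ex_series (fun n => Rabs (a n)) ->
  ex_series (fun n => a n * cos (2 * PI * INR (S n) * x)).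
Proof.
  intros Ha. apply (ex_series_le (K := R_AbsRing) (V := R_CompleteNormedModule))
    with (b := fun n => Rabs (a n)); [|exact Ha].
  intros n; apply Rabs_mult_cos_le.
Qed.

(** Weierstrass test with majorant [Rabs (a n)], on a ball around 0 containing [x]. *)
Lemma cosine_series_continuous (a : nat -> R) (x : R) :
  ex_series (fun n => Rabs (a n)) -> continuity_pt (cosine_series a) x.
Proof.
  intros Ha.
  assert (Hr : 0 < Rabs x + 1) by (assert (H := Rabs_pos x); lra).
  set (r := mkposreal _ Hr).
  assert (Hcvn : CVN_r (fun n x => a n * cos (2 * PI * INR (S n) * x)) r).
  { exists (fun n => Rabs (a n)), (Series (fun n => Rabs (a n))). split.
    - apply is_lim_seq_Reals.
      apply is_lim_seq_ext with (sum_n (fun n => Rabs (a n))).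
      + intros n. rewrite sum_n_Reals. apply sum_eq. intros i _.
        symmetry; apply Rabs_Rabsolu.
      + apply Series_correct; exact Ha.
    - intros n y _. apply Rabs_mult_cos_le. }
  destruct (CVN_CVU_r _ r Hcvn x) as [e He]; [simpl; lra|].
  apply (CVU_continuity _ _ x e He).
  - intros n y _.
    apply continuity_pt_ext with
      (fun y => psum (fun k => a k * cos (2 * PI * INR (S k) * y)) (S n)).
    + intros t. rewrite <- sum_n_psum, sum_n_Reals. reflexivity.
    + apply derivable_continuous_pt.
      exists (psum (fun k => - (a k * (2 * PI * INR (S k)) * sin (2 * PI * INR (S k) * y))) (S n)).
      apply is_derive_Reals.
      apply (is_derive_psum (fun k y => a k * cos (2 * PI * INR (S k) * y))
        (fun k y => - (a k * (2 * PI * INR (S k)) * sin (2 * PI * INR (S k) * y)))).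
      intros k. generalize (INR (S k)); intros t. auto_derive; [exact I|ring].
  - unfold Boule. rewrite Rminus_diag, Rabs_R0. apply cond_pos.
Qed.

Lemma cosine_series_opp (a : nat -> R) (x : R) :
  cosine_series a (- x) = cosine_series a x.
Proof.
  apply Series_ext; intros n.
  rewrite <- (cos_neg (2 * PI * INR (S n) * x)). do 2 f_equal. ring.
Qed.

Lemma cosine_series_periodic (a : nat -> R) (x : R) :
  cosine_series a (x + 1) = cosine_series a x.
Proof.
  apply Series_ext; intros n.
  rewrite <- (cos_period (2 * PI * INR (S n) * x) (S n)). do 2 f_equal. ring.
Qed.

Definition inv_square (n : nat) : R := / INR (S n) ^ 2.

Lemma ex_series_inv_square : ex_series (fun n => Rabs (inv_square n)).
Proof.
  assert (Hpos : forall n, 0 < INR (S n)) by (intros n; apply lt_0_INR; lia).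
  assert (Hb : forall n, psum (fun k => Rabs (inv_square k)) (S n) <= 2 - / INR (S n)).
  { induction n as [|n IH].
    - simpl. unfold inv_square. simpl. rewrite Rabs_pos_eq; lra.
    - change (psum (fun k => Rabs (inv_square k)) (S (S n)))
        with (psum (fun k => Rabs (inv_square k)) (S n) + Rabs (inv_square (S n))).
      unfold inv_square at 2. specialize (Hpos n).
      rewrite (S_INR (S n)). set (t := INR (S n)) in *.
      rewrite Rabs_pos_eq by (left; apply Rinv_0_lt_compat; nra).
      assert (H : / (t + 1) ^ 2 <= / t - / (t + 1)).
      { replace (/ t - / (t + 1)) with (/ (t * (t + 1))) by (field; lra).
        apply Rinv_le_contravar; nra. }
      lra. }
  apply ex_finite_lim_seq_incr with (M := 2).
  - intros n. rewrite sum_Sn. unfold plus; simpl.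
    assert (H := Rabs_pos (inv_square (S n))); lra.
  - intros n. rewrite sum_n_psum.
    apply Rle_trans with (1 := Hb n).
    assert (H := Rinv_0_lt_compat _ (Hpos n)); lra.
Qed.

(** Up to the factor [- 2 PI^2], the bracket is the second derivative of the cosine partial sum
    minus the parabola [PI^2 (x^2 - x)]. *)
Lemma dirichlet_kernel (x : R) (n : nat) :
  sin (PI * x) * (1 + 2 * psum (fun k => cos (2 * PI * INR (S k) * x)) n)
  = sin ((2 * INR n + 1) * (PI * x)).
Proof.
  induction n as [|n IH].
  - simpl. replace ((2 * 0 + 1) * (PI * x)) with (PI * x) by ring. ring.
  - cbn [psum]. rewrite S_INR.
    replace (2 * PI * (INR n + 1) * x) with ((2 * (INR n + 1)) * (PI * x)) by ring.
    replace ((2 * (INR n + 1) + 1) * (PI * x))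
      with (2 * (INR n + 1) * (PI * x) + PI * x) by ring.
    replace ((2 * INR n + 1) * (PI * x))
      with (2 * (INR n + 1) * (PI * x) - PI * x) in IH by ring.
    rewrite sin_plus. rewrite sin_minus in IH.
    set (A := psum _ n) in *. nra.
Qed.

(* [V = 2 sin (M pi x) / (M^2 sin (pi x))] absorbs the main part of the second derivative of
   the error, so that what remains is [O (1 / M)] away from the integers. *)
Lemma cosine_partial_sum_error (x : R) (n : nat) :
  0 < x <= 1 / 2 ->
  let M := 2 * INR n + 1 in
  let R0 := fun y =>
    psum (fun k => inv_square k * cos (2 * PI * INR (S k) * y)) n
    - PI ^ 2 * (y ^ 2 - y) - 2 / M ^ 2 * (sin (M * (PI * y)) / sin (PI * y)) in
  Rabs (R0 x - R0 (1 / 2))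
  <= 2 * PI ^ 2 * (2 / sin (PI * x) ^ 2 + 3 / sin (PI * x) ^ 3) / M.
Proof.
  intros Hx M R0.
  assert (HPI := PI_RGT_0).
  assert (HM : 1 <= M) by (unfold M; assert (H := pos_INR n); lra).
  set (s0 := sin (PI * x)).
  assert (Hs0 : 0 < s0) by (apply sin_gt_0; nra).
  assert (Hs : forall y, x <= y <= 1 / 2 -> s0 <= sin (PI * y)).
  { intros y Hy. apply sin_incr_1; nra. }
  set (B := 2 * PI ^ 2 * (2 / s0 ^ 2 + 3 / s0 ^ 3) / M).
  set (R1 := fun y =>
    psum (fun k => - (2 * PI * / INR (S k) * sin (2 * PI * INR (S k) * y))) n
    - PI ^ 2 * (2 * y - 1)
    - 2 / M ^ 2 * (M * PI * cos (M * (PI * y)) / sin (PI * y)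
                   - PI * sin (M * (PI * y)) * cos (PI * y) / sin (PI * y) ^ 2)).
  (* [R1] and [R2] are the first two derivatives of [R0]. In [R2] the Dirichlet kernel has already
     cancelled against the term of order [M^2] in the second derivative of the correction. *)
  set (R2 := fun y =>
    - (2 / M ^ 2) * (- (2 * M * PI ^ 2 * cos (M * (PI * y)) * cos (PI * y) / sin (PI * y) ^ 2)
       + PI ^ 2 * sin (M * (PI * y))
         * (/ sin (PI * y) + 2 * cos (PI * y) ^ 2 / sin (PI * y) ^ 3))).
  assert (HR0 : forall y, x <= y <= 1 / 2 -> is_derive R0 y (R1 y)).
  { intros y Hy. specialize (Hs y Hy). unfold R0, R1.
    apply (is_derive_minus (V := R_NormedModule)).
    - apply (is_derive_minus (V := R_NormedModule)).
      + apply (is_derive_psum (fun k y => inv_square k * cos (2 * PI * INR (S k) * y))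
          (fun k y => - (2 * PI * / INR (S k) * sin (2 * PI * INR (S k) * y)))).
        intros k. unfold inv_square.
        assert (Ht : INR (S k) <> 0) by (apply not_0_INR; lia).
        generalize (INR (S k)) Ht; intros t Ht'. auto_derive; [exact I|field; exact Ht'].
      + auto_derive; [exact I|ring].
    - auto_derive; [lra|]. field. split; lra. }
  assert (HR1 : forall y, x <= y <= 1 / 2 -> is_derive R1 y (R2 y)).
  { intros y Hy. specialize (Hs y Hy).
    assert (HD := dirichlet_kernel y n). fold M in HD.
    set (D := psum (fun k => cos (2 * PI * INR (S k) * y)) n) in *.
    assert (HP : psum (fun k => - (2 * PI) ^ 2 * cos (2 * PI * INR (S k) * y)) n
                 = - (2 * PI) ^ 2 * D).
    { unfold D. clear. induction n as [|n IH]; cbn [psum]; [ring|]. rewrite IH; ring. }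
    replace (R2 y) with (psum (fun k => - (2 * PI) ^ 2 * cos (2 * PI * INR (S k) * y)) n
      - 2 * PI ^ 2
      - 2 / M ^ 2 * (- (M * PI) ^ 2 * sin (M * (PI * y)) / sin (PI * y)
        - 2 * M * PI ^ 2 * cos (M * (PI * y)) * cos (PI * y) / sin (PI * y) ^ 2
        + PI ^ 2 * sin (M * (PI * y))
          * (/ sin (PI * y) + 2 * cos (PI * y) ^ 2 / sin (PI * y) ^ 3))).
    - unfold R1. apply (is_derive_minus (V := R_NormedModule)).
      + apply (is_derive_minus (V := R_NormedModule)).
        * apply (is_derive_psum
            (fun k y => - (2 * PI * / INR (S k) * sin (2 * PI * INR (S k) * y)))
            (fun k y => - (2 * PI) ^ 2 * cos (2 * PI * INR (S k) * y))).
          intros k.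
          assert (Ht : INR (S k) <> 0) by (apply not_0_INR; lia).
          generalize (INR (S k)) Ht; intros t Ht'. auto_derive; [exact I|field; exact Ht'].
        * auto_derive; [exact I|ring].
      + auto_derive.
        * split; [lra|]. split; [|exact I]. nra.
        * field. split; lra.
    - rewrite HP. unfold R2. rewrite <- HD. field. split; lra. }
  assert (HR2 : forall y, x <= y <= 1 / 2 -> Rabs (R2 y) <= B).
  { intros y Hy. specialize (Hs y Hy).
    assert (Hsin := SIN_bound (M * (PI * y))). assert (Hcos := COS_bound (M * (PI * y))).
    assert (Hc := COS_bound (PI * y)).
    unfold R2.
    set (S := sin (M * (PI * y))) in *. set (C := cos (M * (PI * y))) in *.
    set (s := sin (PI * y)) in *. set (c := cos (PI * y)) in *.
    assert (Hi : 0 < / s <= / s0)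
      by (split; [apply Rinv_0_lt_compat; lra|apply Rinv_le_contravar; lra]).
    assert (Hs1 : s <= 1) by (apply SIN_bound).
    assert (Hs01 : s0 <= 1) by lra.
    assert (Hi1 : 1 <= / s) by (rewrite <- Rinv_1; apply Rinv_le_contravar; lra).
    set (i := / s) in *. set (i0 := / s0) in *.
    assert (HB : B = 2 / M * PI ^ 2 * (2 * i0 ^ 2 + 3 * i0 ^ 3))
      by (unfold B, i0; field; lra).
    assert (H1 : Rabs (C * c) <= 1).
    { rewrite Rabs_mult. assert (Rabs C <= 1) by (apply Rabs_le; lra).
      assert (Rabs c <= 1) by (apply Rabs_le; lra).
      assert (0 <= Rabs C) by apply Rabs_pos. assert (0 <= Rabs c) by apply Rabs_pos. nra. }
    assert (Hii : i ^ 2 <= i0 ^ 2) by (apply pow_incr; lra).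
    assert (Hiii : i ^ 3 <= i0 ^ 3) by (apply pow_incr; lra).
    assert (Hi3 : 0 < i ^ 3) by (apply pow_lt; lra).
    assert (Hi2 : 0 < i ^ 2) by (apply pow_lt; lra).
    assert (H2 : Rabs (S * (i + 2 * c ^ 2 * i ^ 3)) <= 3 * i0 ^ 3).
    { assert (Hc2 : 0 <= c ^ 2 <= 1) by nra.
      assert (Hii3 : i <= i ^ 3) by (simpl; nra).
      rewrite Rabs_mult.
      assert (0 <= Rabs S <= 1) by (split; [apply Rabs_pos|apply Rabs_le; lra]).
      assert (Hci : 0 <= c ^ 2 * i ^ 3 <= i ^ 3)
        by (set (c2 := c ^ 2) in *; set (i3 := i ^ 3) in *; split; nra).
      rewrite (Rabs_pos_eq (i + _)) by lra.
      apply Rle_trans with (1 * (i + 2 * c ^ 2 * i ^ 3)); [|lra].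
      apply Rmult_le_compat_r; lra. }
    replace (- (2 / M ^ 2) * _)
      with (2 / M * PI ^ 2 * (2 * i ^ 2 * (C * c) - (S * (i + 2 * c ^ 2 * i ^ 3)) / M))
      by (unfold i; field; split; lra).
    rewrite HB, Rabs_mult, (Rabs_pos_eq (2 / M * PI ^ 2)).
    2:{ apply Rmult_le_pos; [|nra]. apply Rlt_le, Rdiv_lt_0_compat; lra. }
    apply Rmult_le_compat_l.
    { apply Rmult_le_pos; [|nra]. apply Rlt_le, Rdiv_lt_0_compat; lra. }
    apply Rle_trans with (1 := Rabs_triang _ _). rewrite Rabs_Ropp.
    apply Rplus_le_compat.
    - rewrite Rabs_mult, (Rabs_pos_eq (2 * i ^ 2)) by lra.
      assert (0 <= Rabs (C * c)) by apply Rabs_pos. nra.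
    - unfold Rdiv. rewrite Rabs_mult.
      assert (HiM : 0 < / M <= 1).
      { split; [apply Rinv_0_lt_compat; lra|]. rewrite <- Rinv_1.
        apply Rinv_le_contravar; lra. }
      rewrite (Rabs_pos_eq (/ M)) by lra.
      assert (0 <= Rabs (S * (i + 2 * c ^ 2 * i ^ 3))) by apply Rabs_pos. nra. }
  (* Every term vanishes at 1/2, [M] being odd. Two uses of the mean value theorem from 1/2 then
     carry the bound [B] from [R2] to [R1] and to [R0]. *)
  assert (HR1half : R1 (1 / 2) = 0).
  { unfold R1.
    assert (Hp : psum (fun k => - (2 * PI * / INR (S k) * sin (2 * PI * INR (S k) * (1 / 2)))) n
                 = 0).
    { clear. induction n as [|n IH]; [reflexivity|]. cbn [psum]. rewrite IH.
      rewrite (sin_eq_0_1 (2 * PI * INR (S n) * (1 / 2))); [ring|].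
      exists (Z.of_nat (S n)). rewrite <- INR_IZR_INZ. field. }
    rewrite Hp, (cos_eq_0_1 (M * (PI * (1 / 2)))).
    - replace (PI * (1 / 2)) with (PI / 2) by field. rewrite cos_PI2, sin_PI2.
      field. lra.
    - exists (Z.of_nat n). rewrite <- INR_IZR_INZ. unfold M. field. }
  assert (HB0 : 0 <= B).
  { apply Rle_trans with (2 := HR2 x ltac:(lra)). apply Rabs_pos. }
  assert (HR1b : forall y, x <= y <= 1 / 2 -> Rabs (R1 y) <= B).
  { intros y Hy.
    destruct (MVT_gen R1 y (1 / 2) R2) as (z & Hz & Hzeq).
    - intros t. rewrite Rmin_left, Rmax_right by lra. intros Ht. apply HR1; lra.
    - intros t. rewrite Rmin_left, Rmax_right by lra. intros Ht.
      apply derivable_continuous_pt. exists (R2 t).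
      apply is_derive_Reals, HR1; lra.
    - rewrite Rmin_left, Rmax_right in Hz by lra.
      rewrite HR1half in Hzeq.
      replace (R1 y) with (- (R2 z * (1 / 2 - y))) by lra.
      rewrite Rabs_Ropp, Rabs_mult, (Rabs_pos_eq (1 / 2 - y)) by lra.
      specialize (HR2 z ltac:(lra)). assert (H := Rabs_pos (R2 z)). nra. }
  destruct (MVT_gen R0 x (1 / 2) R1) as (z & Hz & Hzeq).
  - intros t. rewrite Rmin_left, Rmax_right by lra. intros Ht. apply HR0; lra.
  - intros t. rewrite Rmin_left, Rmax_right by lra. intros Ht.
    apply derivable_continuous_pt. exists (R1 t).
    apply is_derive_Reals, HR0; lra.
  - rewrite Rmin_left, Rmax_right in Hz by lra.
    rewrite Rabs_minus_sym, Hzeq.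
    rewrite Rabs_mult, (Rabs_pos_eq (1 / 2 - x)) by lra.
    specialize (HR1b z ltac:(lra)). assert (H := Rabs_pos (R1 z)). fold B. nra.
Qed.

Lemma is_lim_seq_inv_INR_S (C : R) : is_lim_seq (fun n => C * / INR (S n)) 0.
Proof.
  replace (Finite 0) with (Rbar_mult C 0) by (simpl; f_equal; ring).
  apply is_lim_seq_scal_l.
  replace (Finite 0) with (Rbar_inv p_infty) by reflexivity.
  apply is_lim_seq_inv; [|discriminate].
  apply (is_lim_seq_incr_1 INR), is_lim_seq_INR.
Qed.

Lemma cosine_series_partial_sums (a : nat -> R) (x : R) :
  ex_series (fun n => Rabs (a n)) ->
  is_lim_seq (psum (fun n => a n * cos (2 * PI * INR (S n) * x))) (cosine_series a x).
Proof.
  intros Ha. apply is_lim_seq_psum, Series_correct, ex_series_cosine, Ha.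
Qed.

(** The error estimate is passed to the limit; the correction term itself also tends to 0, so the
    partial sums are squeezed. *)
Lemma inv_square_series_half (x : R) :
  0 < x <= 1 / 2 ->
  cosine_series inv_square x
  = cosine_series inv_square (1 / 2) + PI ^ 2 * (x ^ 2 - x + 1 / 4).
Proof.
  intros Hx.
  assert (HPI := PI_RGT_0).
  set (s0 := sin (PI * x)).
  assert (Hs0 : 0 < s0) by (apply sin_gt_0; nra).
  assert (His0 : 0 < / s0) by (apply Rinv_0_lt_compat, Hs0).
  set (B := 2 * PI ^ 2 * (2 / s0 ^ 2 + 3 / s0 ^ 3)).
  set (u := fun n => psum (fun k => inv_square k * cos (2 * PI * INR (S k) * x)) n
    - psum (fun k => inv_square k * cos (2 * PI * INR (S k) * (1 / 2))) n
    - PI ^ 2 * (x ^ 2 - x + 1 / 4)).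
  assert (Hu : is_lim_seq u (cosine_series inv_square x - cosine_series inv_square (1 / 2)
    - PI ^ 2 * (x ^ 2 - x + 1 / 4))).
  { apply is_lim_seq_minus'; [|apply is_lim_seq_const].
    apply is_lim_seq_minus'; apply cosine_series_partial_sums, ex_series_inv_square. }
  assert (Hu0 : is_lim_seq u 0).
  { apply is_lim_seq_abs_0.
    apply is_lim_seq_le_le with (fun _ => 0) (fun n => (B + (2 * / s0 + 2)) * / INR (S n)).
    3: apply is_lim_seq_inv_INR_S.
    2: apply is_lim_seq_const.
    intros n. split; [apply Rabs_pos|].
    assert (HE := cosine_partial_sum_error x n Hx). cbv beta zeta in HE.
    fold s0 in HE. fold B in HE. rewrite S_INR.
    assert (Hn := pos_INR n).
    set (M := 2 * INR n + 1) in *.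
    assert (HM : INR n + 1 <= M) by (unfold M; lra).
    assert (HiM : 0 < / M <= / (INR n + 1))
      by (split; [apply Rinv_0_lt_compat; lra|apply Rinv_le_contravar; lra]).
    assert (HiM1 : / M <= 1) by (rewrite <- Rinv_1; apply Rinv_le_contravar; lra).
    replace (PI * (1 / 2)) with (PI / 2) in HE by field.
    rewrite sin_PI2 in HE.
    set (v1 := sin (M * (PI * x))) in *. set (v2 := sin (M * (PI / 2))) in *.
    assert (Hv1 := SIN_bound (M * (PI * x))). fold v1 in Hv1.
    assert (Hv2 := SIN_bound (M * (PI / 2))). fold v2 in Hv2.
    match type of HE with Rabs ?t <= _ =>
      replace (u n) with (t + 2 / M ^ 2 * (v1 / s0 - v2)) by (unfold u; field; split; lra) end.
    apply Rle_trans with (1 := Rabs_triang _ _).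
    assert (HV : Rabs (2 / M ^ 2 * (v1 / s0 - v2)) <= (2 * / s0 + 2) * / M).
    { replace (2 / M ^ 2 * (v1 / s0 - v2)) with (2 * / M * (v1 / s0 - v2) * / M)
        by (field; lra).
      rewrite Rabs_mult, (Rabs_pos_eq (/ M)) by lra.
      apply Rmult_le_compat_r; [lra|].
      rewrite Rabs_mult, (Rabs_pos_eq (2 * / M)) by lra.
      assert (Habs : Rabs (v1 / s0 - v2) <= / s0 + 1).
      { apply Rabs_le. unfold Rdiv. split; nra. }
      assert (0 <= Rabs (v1 / s0 - v2)) by apply Rabs_pos. nra. }
    assert (HB : 0 <= B).
    { assert (H : 0 <= B / M) by (apply Rle_trans with (2 := HE), Rabs_pos).
      replace B with (B / M * M) by (field; lra). nra. }
    apply Rle_trans with (B * / M + (2 * / s0 + 2) * / M).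
    - apply Rplus_le_compat; [exact HE|exact HV].
    - nra. }
  assert (H := is_lim_seq_unique _ _ Hu). rewrite (is_lim_seq_unique _ _ Hu0) in H.
  injection H; lra.
Qed.

(** The error bound degenerates at 0, so the formula is extended there by continuity. *)
Lemma inv_square_series_zero :
  cosine_series inv_square 0 = cosine_series inv_square (1 / 2) + PI ^ 2 / 4.
Proof.
  set (d := fun x => cosine_series inv_square x
    - (cosine_series inv_square (1 / 2) + PI ^ 2 * (x ^ 2 - x + 1 / 4))).
  assert (Hd : continuity_pt d 0).
  { apply continuity_pt_minus.
    - apply cosine_series_continuous, ex_series_inv_square.
    - apply derivable_continuous_pt. exists (- PI ^ 2).
      apply is_derive_Reals. auto_derive; [exact I|ring]. }
  assert (Hd0 : d 0 = 0).
  { destruct (Req_dec (d 0) 0) as [H0|H0]; [exact H0|exfalso].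
    assert (Hpos : 0 < Rabs (d 0)) by (apply Rabs_pos_lt; exact H0).
    destruct (proj1 (continuity_pt_locally d 0) Hd (mkposreal _ Hpos)) as [e He].
    assert (Hx : 0 < Rmin (e / 2) (1 / 2)).
    { apply Rmin_pos; [|lra]. assert (H := cond_pos e); lra. }
    set (x := Rmin (e / 2) (1 / 2)) in *.
    assert (Hx2 : x <= 1 / 2) by apply Rmin_r.
    assert (Hxe : x <= e / 2) by apply Rmin_l.
    assert (Hc : Rabs (d x - d 0) < Rabs (d 0)).
    { apply (He x). unfold ball; simpl; unfold AbsRing_ball, abs, minus, plus, opp; simpl.
      rewrite Ropp_0, Rplus_0_r, Rabs_pos_eq by lra. assert (H := cond_pos e); lra. }
    assert (Hdx : d x = 0) by (unfold d; rewrite (inv_square_series_half x); lra).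
    rewrite Hdx in Hc.
    replace (0 - d 0) with (- d 0) in Hc by ring. rewrite Rabs_Ropp in Hc. lra. }
  unfold d in Hd0. lra.
Qed.

(* Odd frequencies cancel between [0] and [1/2]; even ones reproduce the series at [0]. *)
Lemma inv_square_duplication :
  cosine_series inv_square 0 + cosine_series inv_square (1 / 2)
  = / 2 * cosine_series inv_square 0.
Proof.
  set (A := psum (fun k => inv_square k * cos (2 * PI * INR (S k) * 0))).
  set (H := psum (fun k => inv_square k * cos (2 * PI * INR (S k) * (1 / 2)))).
  assert (HA : is_lim_seq A (cosine_series inv_square 0))
    by apply cosine_series_partial_sums, ex_series_inv_square.
  assert (HH : is_lim_seq H (cosine_series inv_square (1 / 2)))
    by apply cosine_series_partial_sums, ex_series_inv_square.
  assert (Heq : forall n, A (2 * n)%nat + H (2 * n)%nat = / 2 * A n).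
  { assert (Hodd : forall n, cos (2 * PI * INR (S (2 * n)) * (1 / 2)) = - 1).
    { intros n. rewrite S_INR, mult_INR.
      replace (2 * PI * (INR 2 * INR n + 1) * (1 / 2)) with (PI + 2 * INR n * PI)
        by (simpl; field).
      rewrite cos_period. apply cos_PI. }
    assert (Heven : forall n, cos (2 * PI * INR (S (S (2 * n))) * (1 / 2)) = 1).
    { intros n. replace (S (S (2 * n))) with (2 * S n)%nat by lia.
      rewrite mult_INR.
      replace (2 * PI * (INR 2 * INR (S n)) * (1 / 2)) with (0 + 2 * INR (S n) * PI)
        by (simpl (INR 2); field).
      rewrite cos_period. apply cos_0. }
    induction n as [|n IH].
    - unfold A, H; simpl; ring.
    - replace (2 * S n)%nat with (S (S (2 * n))) by lia.
      unfold A, H in *. cbn [psum].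
      rewrite Hodd, Heven, !Rmult_0_r, cos_0.
      rewrite Rmult_plus_distr_l, <- IH.
      assert (Hsq : inv_square (S (2 * n)) = / 4 * inv_square n).
      { unfold inv_square. replace (S (S (2 * n))) with (2 * S n)%nat by lia.
        rewrite mult_INR. simpl (INR 2). field. apply not_0_INR; lia. }
      rewrite Hsq. field. }
  assert (Hsub : filterlim (fun n => (2 * n)%nat) eventually eventually).
  { apply eventually_subseq. intros n; lia. }
  assert (L1 : is_lim_seq (fun n => A (2 * n)%nat + H (2 * n)%nat)
                 (cosine_series inv_square 0 + cosine_series inv_square (1 / 2))).
  { apply is_lim_seq_plus'.
    - apply (is_lim_seq_subseq A _ _ Hsub HA).
    - apply (is_lim_seq_subseq H _ _ Hsub HH). }
  assert (L2 : is_lim_seq (fun n => A (2 * n)%nat + H (2 * n)%nat)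
                 (/ 2 * cosine_series inv_square 0)).
  { apply is_lim_seq_ext with (fun n => / 2 * A n); [intros n; symmetry; apply Heq|].
    apply (is_lim_seq_scal_l A (/ 2) (cosine_series inv_square 0) HA). }
  assert (E := is_lim_seq_unique _ _ L1). rewrite (is_lim_seq_unique _ _ L2) in E.
  injection E; lra.
Qed.

(** The two relations between the values at 0 and 1/2 determine both; the value at 0 is [PI^2 / 6].
    Evenness and periodicity then extend the formula from [[0, 1/2]]. *)
Lemma inv_square_series (x : R) :
  Rabs x <= 1 ->
  cosine_series inv_square x = PI ^ 2 * (x ^ 2 - Rabs x + 1 / 6).
Proof.
  assert (Hz := inv_square_series_zero). assert (Hd := inv_square_duplication).
  assert (Hhalf : forall y, 0 <= y <= 1 / 2 ->
            cosine_series inv_square y = PI ^ 2 * (y ^ 2 - y + 1 / 6)).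
  { intros y Hy. destruct (Req_dec y 0) as [->|H0].
    - replace (PI ^ 2 * (0 ^ 2 - 0 + 1 / 6)) with (PI ^ 2 / 6) by field. lra.
    - rewrite inv_square_series_half; lra. }
  assert (Hpos : forall y, 0 <= y <= 1 ->
            cosine_series inv_square y = PI ^ 2 * (y ^ 2 - y + 1 / 6)).
  { intros y Hy. destruct (Rle_dec y (1 / 2)) as [H|H]; [apply Hhalf; lra|].
    rewrite <- cosine_series_opp, <- cosine_series_periodic, Hhalf by lra. field. }
  intros Hx. unfold Rabs in *. destruct (Rcase_abs x) as [H|H].
  - rewrite <- cosine_series_opp, Hpos by lra. ring.
  - apply Hpos; lra.
Qed.

(** * Absolute convergence for badly approximable numbers *)

Definition badly_approximable (rho : R) : Prop :=
  exists c, 0 < c /\ forall (n : nat) (m : Z), (0 < n)%nat ->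
    c / INR n <= Rabs (INR n * rho - IZR m).

Lemma badly_approximable_irrational (rho : R) : badly_approximable rho -> irrational rho.
Proof.
  intros (c & Hc & H) a b Ha Heq.
  assert (Hn : (0 < Z.abs_nat a)%nat) by lia.
  assert (Hpos := lt_0_INR _ Hn).
  assert (Hq : 0 < c / INR (Z.abs_nat a)) by (apply Rdiv_lt_0_compat; lra).
  destruct (Z_lt_le_dec a 0) as [Hs|Hs].
  - specialize (H (Z.abs_nat a) b Hn).
    rewrite INR_IZR_INZ in H at 2. rewrite Zabs2Nat.id_abs, Z.abs_neq, opp_IZR in H by lia.
    replace (- IZR a * rho - IZR b) with 0 in H by lra. rewrite Rabs_R0 in H. lra.
  - specialize (H (Z.abs_nat a) (- b)%Z Hn).
    rewrite INR_IZR_INZ in H at 2. rewrite Zabs2Nat.id_abs, Z.abs_eq, opp_IZR in H by lia.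
    replace (IZR a * rho - - IZR b) with 0 in H by lra. rewrite Rabs_R0 in H. lra.
Qed.

(** Distinct indices below [M], in any order, pick some of the positive terms of a telescoping
    sum. *)
Lemma sum_distinct_telescope (M : nat) (l : list nat) :
  NoDup l -> (forall k, In k l -> (k < M)%nat) ->
  fold_right Rplus 0 (map (fun k => / INR (S k) - / INR (S (S k))) l) <= 1 - / INR (S M).
Proof.
  revert l; induction M as [|M IH]; intros l Hnd Hl.
  - destruct l as [|k l]; [simpl; lra|]. exfalso. specialize (Hl k (or_introl eq_refl)). lia.
  - destruct (in_dec Nat.eq_dec M l) as [Hin|Hout].
    + destruct (in_split _ _ Hin) as (l1 & l2 & ->).
      apply NoDup_remove in Hnd. destruct Hnd as [Hnd Hout].
      specialize (IH (l1 ++ l2) Hnd).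
      assert (Hl' : forall k, In k (l1 ++ l2) -> (k < M)%nat).
      { intros k Hk. assert (k <> M) by (intros ->; contradiction).
        assert (k < S M)%nat; [|lia]. apply Hl. apply in_or_app.
        apply in_app_or in Hk. simpl; tauto. }
      specialize (IH Hl').
      assert (Hfold : forall (l l' : list R),
        fold_right Rplus 0 (l ++ l') = fold_right Rplus 0 l + fold_right Rplus 0 l').
      { intros m m'; induction m as [|t m IHm]; simpl; [|rewrite IHm]; ring. }
      rewrite map_app, Hfold in *. cbn [map fold_right]. lra.
    + apply Rle_trans with (1 - / INR (S M)).
      * apply IH; [exact Hnd|]. intros k Hk.
        assert (k <> M) by (intros ->; contradiction). specialize (Hl k Hk). lia.
      * assert (/ INR (S (S M)) <= / INR (S M)); [|lra].
        apply Rinv_le_contravar; [apply lt_0_INR; lia|apply le_INR; lia].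
Qed.

Lemma psum_fold_right (f : nat -> R) (n : nat) :
  psum f n = fold_right Rplus 0 (map f (seq 0 n)).
Proof.
  assert (Hfold : forall (l : list R) y,
    fold_right Rplus 0 (l ++ y :: nil) = fold_right Rplus 0 l + y).
  { intros l y; induction l as [|t l IHl]; simpl; [|rewrite IHl]; ring. }
  induction n as [|n IH]; [reflexivity|].
  rewrite seq_S, map_app. cbn [map psum]. rewrite Hfold, IH. reflexivity.
Qed.

Lemma psum_le (f g : nat -> R) (n : nat) :
  (forall k, (k < n)%nat -> f k <= g k) -> psum f n <= psum g n.
Proof.
  induction n as [|n IH]; intros H; simpl; [lra|].
  apply Rplus_le_compat; [apply IH; intros k Hk|]; apply H; lia.
Qed.

Lemma psum_scal (c : R) (f : nat -> R) (n : nat) :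
  psum (fun k => c * f k) n = c * psum f n.
Proof. induction n as [|n IH]; simpl; [|rewrite IH]; ring. Qed.

(* The integer parts of [x n / d] are pairwise distinct. *)
Lemma sum_separated_inv_squares (x : nat -> R) (N : nat) (d : R) :
  0 < d ->
  (forall n, (n < N)%nat -> d / 4 <= x n) ->
  (forall i j, (i < N)%nat -> (j < i)%nat -> d <= Rabs (x i - x j)) ->
  psum (fun n => / x n ^ 2) N <= 32 / d ^ 2.
Proof.
  intros Hd Hx Hsep.
  set (g := fun n => Z.to_nat (Int_part (x n / d))).
  assert (Hg : forall n, (n < N)%nat -> INR (g n) <= x n / d < INR (g n) + 1).
  { intros n Hn. specialize (Hx n Hn). assert (Hf := Int_part_bounds (x n / d)).
    assert (H0 : 0 < x n / d) by (apply Rdiv_lt_0_compat; lra).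
    unfold g. rewrite INR_IZR_INZ, Z2Nat.id; [exact Hf|].
    assert (-1 < Int_part (x n / d))%Z by (apply lt_IZR; lra). lia. }
  assert (Hlt : forall i j, (i < N)%nat -> (j < i)%nat -> g i <> g j).
  { intros i j Hi Hj Heq. specialize (Hsep i j Hi Hj).
    assert (Hgi := Hg i Hi). assert (Hgj := Hg j ltac:(lia)). rewrite Heq in Hgi.
    assert (Habs : Rabs (x i / d - x j / d) < 1) by (apply Rabs_def1; lra).
    replace (x i - x j) with ((x i / d - x j / d) * d) in Hsep by (field; lra).
    rewrite Rabs_mult, (Rabs_pos_eq d) in Hsep by lra. nra. }
  assert (Hnd : NoDup (map g (seq 0 N))).
  { apply NoDup_map_NoDup_ForallPairs; [|apply seq_NoDup].
    intros i j Hi Hj Heq. apply in_seq in Hi. apply in_seq in Hj.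
    destruct (Nat.lt_trichotomy i j) as [H|[H|H]]; [|exact H|].
    - exfalso. apply (Hlt j i); [lia|lia|congruence].
    - exfalso. apply (Hlt i j); [lia|lia|congruence]. }
  assert (Hsum : psum (fun n => / INR (S (g n)) - / INR (S (S (g n)))) N <= 1).
  { rewrite psum_fold_right.
    set (M := S (list_max (map g (seq 0 N)))).
    rewrite <- (map_map g (fun k => / INR (S k) - / INR (S (S k)))).
    apply Rle_trans with (1 - / INR (S M)).
    - apply sum_distinct_telescope; [exact Hnd|]. intros k Hk. unfold M.
      assert (Hmax := proj1 (list_max_le (map g (seq 0 N)) _) (le_n _)).
      rewrite Forall_forall in Hmax. specialize (Hmax k Hk). lia.
    - assert (0 < / INR (S M)) by (apply Rinv_0_lt_compat, lt_0_INR; lia). lra. }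
  apply Rle_trans with
    (psum (fun n => 32 / d ^ 2 * (/ INR (S (g n)) - / INR (S (S (g n))))) N).
  - apply psum_le. intros n Hn. specialize (Hx n Hn). specialize (Hg n Hn).
    rewrite !S_INR.
    assert (Hcase : g n = 0%nat \/ 1 <= INR (g n)).
    { destruct (g n); [left; reflexivity|right]. rewrite S_INR.
      assert (H := pos_INR n0); lra. }
    assert (Hk0 := pos_INR (g n)).
    set (k := INR (g n)) in *.
    assert (Hy : 1 / 4 <= x n / d).
    { apply Rmult_le_reg_r with d; [lra|]. unfold Rdiv at 2.
      rewrite Rmult_assoc, Rinv_l; lra. }
    assert (Hxy : x n = x n / d * d) by (field; lra).
    set (y := x n / d) in *. rewrite Hxy.
    replace (/ (y * d) ^ 2) with (/ d ^ 2 * / y ^ 2) by (field; lra).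
    replace (32 / d ^ 2 * (/ (k + 1) - / (k + 1 + 1)))
      with (/ d ^ 2 * / ((k + 1) * (k + 2) / 32)) by (field; lra).
    apply Rmult_le_compat_l; [left; apply Rinv_0_lt_compat, pow_lt; lra|].
    apply Rinv_le_contravar; [nra|].
    (* The constant 32 comes from [k = 0], where [y >= 1/4] and [2 / 32 = 1 / 16]; for [k >= 1] the
       bound [y >= k] is ample. *)
    destruct Hcase as [H|H].
    + assert (Hk : k = 0) by (unfold k; rewrite H; reflexivity). rewrite Hk. nra.
    + nra.
  - rewrite psum_scal. rewrite <- (Rmult_1_r (32 / d ^ 2)) at 2.
    apply Rmult_le_compat_l; [|exact Hsum].
    apply Rlt_le, Rdiv_lt_0_compat; [lra|apply pow_lt; lra].
Qed.

(** With [t = PI e] in [[0, 2]], the cubic Taylor bound gives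
    [sin t >= t (1 - t^2 / 6) >= t / 3 >= e]. *)
Lemma sin_PI_mult_ge (e : R) : 0 <= e <= 1 / 2 -> e <= sin (PI * e).
Proof.
  intros He. assert (H3 := PI2_3_2). assert (H4 := PI_4).
  assert (Hb := proj1 (sin_bound (PI * e) 0 ltac:(nra) ltac:(nra))).
  unfold sin_approx, sin_term in Hb. simpl in Hb.
  set (t := PI * e) in *.
  assert (Ht : 0 <= t <= 2) by (unfold t; nra).
  assert (Het : 3 * e <= t) by (unfold t; nra).
  assert (Hl : t - t * t * t / 6 <= sin t).
  { apply Rle_trans with (2 := Hb). right. field. }
  nra.
Qed.

(** The nearer of the endpoints 0 and 1 controls the sine; adding both terms avoids recording which
    one it is. *)
Lemma inv_sin_PI_sqr_le (e : R) :
  0 < e < 1 -> / sin (PI * e) ^ 2 <= / e ^ 2 + / (1 - e) ^ 2.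
Proof.
  intros He.
  assert (H1 : 0 < / e ^ 2) by (apply Rinv_0_lt_compat, pow_lt; lra).
  assert (H2 : 0 < / (1 - e) ^ 2) by (apply Rinv_0_lt_compat, pow_lt; lra).
  destruct (Rle_dec e (1 / 2)) as [H|H].
  - assert (Hs := sin_PI_mult_ge e ltac:(lra)).
    assert (/ sin (PI * e) ^ 2 <= / e ^ 2); [|lra].
    apply Rinv_le_contravar; [apply pow_lt; lra|apply pow_incr; lra].
  - assert (Hs := sin_PI_mult_ge (1 - e) ltac:(lra)).
    replace (PI * (1 - e)) with (PI - PI * e) in Hs by ring.
    rewrite sin_PI_x in Hs.
    assert (/ sin (PI * e) ^ 2 <= / (1 - e) ^ 2); [|lra].
    apply Rinv_le_contravar; [apply pow_lt; lra|apply pow_incr; lra].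
Qed.

(** The squared cosine is [sin (PI e)^2] with [e] the fractional part of [n rho + 1/2]. For
    [d = c / N] the points [e], and likewise [1 - e], are [d]-separated and at least [d / 4]; each
    family contributes [32 / d^2]. *)
Lemma sum_sec_sqr_le (rho : R) :
  badly_approximable rho ->
  exists C, 0 < C /\ forall N : nat,
    psum (fun n => sec (INR (S n) * PI * rho) ^ 2) N <= C * INR N ^ 2.
Proof.
  intros (c & Hc & Hba). exists (64 / c ^ 2).
  split; [apply Rdiv_lt_0_compat; [lra|apply pow_lt, Hc]|].
  intros N.
  destruct (Nat.eq_dec N 0) as [->|HN]; [simpl; lra|].
  assert (HN0 : 0 < INR N) by (apply lt_0_INR; lia).
  set (f := fun n => Int_part (INR (S n) * rho + 1 / 2)).
  set (e := fun n => INR (S n) * rho + 1 / 2 - IZR (f n)).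
  set (d := c / INR N).
  assert (Hd : 0 < d) by (apply Rdiv_lt_0_compat; lra).
  assert (He : forall n, 0 <= e n < 1).
  { intros n. unfold e. assert (H := Int_part_bounds (INR (S n) * rho + 1 / 2)).
    fold (f n) in H. lra. }
  assert (Hdn : forall k, (0 < k <= N)%nat -> d <= c / INR k).
  { intros k Hk. unfold d, Rdiv. apply Rmult_le_compat_l; [lra|].
    apply Rinv_le_contravar; [apply lt_0_INR; lia|apply le_INR; lia]. }
  (* Doubling compares [2 n rho] with an odd integer; the doubled distance and the doubled index
     together cost the factor 4. *)
  assert (Hd2 : forall n (m : Z), (n < N)%nat ->
            d / 4 <= Rabs (INR (S n) * rho + 1 / 2 - IZR m)).
  { intros n m Hn. assert (H := Hba (2 * S n)%nat (2 * m - 1)%Z ltac:(lia)).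
    assert (HdS := Hdn (S n) ltac:(lia)).
    rewrite mult_INR, minus_IZR, mult_IZR in H. change (INR 2) with 2 in H.
    replace (2 * INR (S n) * rho - (2 * IZR m - 1))
      with (2 * (INR (S n) * rho + 1 / 2 - IZR m)) in H by field.
    rewrite Rabs_mult, (Rabs_pos_eq 2) in H by lra.
    replace (c / (2 * INR (S n))) with (c / INR (S n) / 2) in H
      by (field; apply not_0_INR; lia).
    lra. }
  assert (He1 : forall n, (n < N)%nat -> d / 4 <= e n).
  { intros n Hn. specialize (Hd2 n (f n) Hn). fold (e n) in Hd2.
    rewrite Rabs_pos_eq in Hd2 by apply He. exact Hd2. }
  assert (He2 : forall n, (n < N)%nat -> d / 4 <= 1 - e n).
  { intros n Hn. specialize (Hd2 n (f n + 1)%Z Hn). rewrite plus_IZR in Hd2.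
    replace (INR (S n) * rho + 1 / 2 - (IZR (f n) + 1)) with (- (1 - e n)) in Hd2
      by (unfold e; ring).
    rewrite Rabs_Ropp, Rabs_pos_eq in Hd2 by (specialize (He n); lra). exact Hd2. }
  assert (Hsep : forall i j, (i < N)%nat -> (j < i)%nat -> d <= Rabs (e i - e j)).
  { intros i j Hi Hj. assert (H := Hba (i - j)%nat (f i - f j)%Z ltac:(lia)).
    assert (HdS := Hdn (i - j)%nat ltac:(lia)).
    rewrite (minus_INR i j), minus_IZR in H by lia.
    rewrite minus_INR in HdS by lia.
    replace (e i - e j) with ((INR i - INR j) * rho - (IZR (f i) - IZR (f j)))
      by (unfold e; rewrite !S_INR; ring).
    lra. }
  assert (S1 := sum_separated_inv_squares e N d Hd He1 Hsep).
  assert (S2 : psum (fun n => / (1 - e n) ^ 2) N <= 32 / d ^ 2).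
  { apply (sum_separated_inv_squares (fun n => 1 - e n) N d Hd He2).
    intros i j Hi Hj. replace (1 - e i - (1 - e j)) with (- (e i - e j)) by ring.
    rewrite Rabs_Ropp. apply Hsep; assumption. }
  apply Rle_trans with (psum (fun n => / e n ^ 2) N + psum (fun n => / (1 - e n) ^ 2) N).
  - assert (Hplus : forall (u v : nat -> R) k,
      psum (fun n => u n + v n) k = psum u k + psum v k).
    { intros u v k; induction k as [|k IH]; simpl; [|rewrite IH]; ring. }
    rewrite <- Hplus. apply psum_le. intros n Hn.
    specialize (He1 n Hn). specialize (He2 n Hn).
    apply Rle_trans with (2 := inv_sin_PI_sqr_le (e n) ltac:(lra)). right.
    assert (Hsin : sin (PI * e n) ^ 2 = cos (INR (S n) * PI * rho) ^ 2).
    { replace (PI * e n) with ((INR (S n) * PI * rho + PI / 2) + IZR (- f n) * PI)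
        by (unfold e; rewrite opp_IZR; field).
      rewrite sin_plus.
      rewrite (sin_eq_0_1 (IZR (- f n) * PI)) by (exists (- f n)%Z; reflexivity).
      assert (Hcos : cos (IZR (- f n) * PI) ^ 2 = 1).
      { assert (H := sin2_cos2 (IZR (- f n) * PI)).
        rewrite (sin_eq_0_1 (IZR (- f n) * PI)) in H by (exists (- f n)%Z; reflexivity).
        unfold Rsqr in H. lra. }
      rewrite Rmult_0_r, Rplus_0_r, Rpow_mult_distr, Hcos.
      rewrite (Rplus_comm _ (PI / 2)), <- cos_sin. ring. }
    rewrite Hsin. unfold sec. rewrite pow_inv. reflexivity.
  - replace (64 / c ^ 2 * INR N ^ 2) with (32 / d ^ 2 + 32 / d ^ 2)
      by (unfold d; field; lra).
    lra.
Qed.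

Lemma psum_increment_le (f s : nat -> R) (A B : R) (a n : nat) :
  (forall k, (a <= k)%nat -> f k <= A * s k + B) ->
  psum f (a + n) - psum f a <= A * (psum s (a + n) - psum s a) + B * INR n.
Proof.
  intros H; induction n as [|n IH].
  - rewrite Nat.add_0_r. simpl. lra.
  - rewrite Nat.add_succ_r, S_INR. cbn [psum].
    specialize (H (a + n)%nat ltac:(lia)). lra.
Qed.

(* Over the block [4^k, 4^(k+1)) use [2 |sec| <= sec^2 / 2^k + 2^k]. *)
Lemma ex_series_sec (rho : R) :
  badly_approximable rho ->
  ex_series (fun n => Rabs (sec (INR (S n) * PI * rho) / INR (S n) ^ 2)).
Proof.
  intros Hba. destruct (sum_sec_sqr_le rho Hba) as (C & HC & Hs).
  set (s := fun n => sec (INR (S n) * PI * rho) ^ 2) in *.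
  set (f := fun n => Rabs (sec (INR (S n) * PI * rho) / INR (S n) ^ 2)).
  assert (Hf : forall n, 0 <= f n) by (intros n; apply Rabs_pos).
  assert (Hspos : forall n, 0 <= psum s n).
  { induction n as [|n IH]; simpl; [lra|]. assert (0 <= s n); [apply pow2_ge_0|lra]. }
  assert (Hblock : forall k, psum f (4 ^ S k) - psum f (4 ^ k) <= (8 * C + 2) * / 2 ^ k).
  { intros k.
    set (t := 2 ^ k).
    assert (Ht : 0 < t) by (apply pow_lt; lra).
    assert (H4 : INR (4 ^ k) = t ^ 2).
    { rewrite pow_INR. unfold t. rewrite <- pow_mult, Nat.mul_comm, pow_mult.
      f_equal. simpl; ring. }
    (* With [t = 2^k] and indices at least [t^2], each term is at most [|z| / t^4]; the two
       coefficients come from [2 |z| t <= z^2 + t^2]. *)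
    assert (Hinc := psum_increment_le f s (/ (2 * t ^ 5)) (/ (2 * t ^ 3)) (4 ^ k) (3 * 4 ^ k)).
    replace (4 ^ k + 3 * 4 ^ k)%nat with (4 ^ S k)%nat in Hinc by (simpl; lia).
    rewrite mult_INR, H4 in Hinc.
    assert (Hb := Hs (4 ^ S k)%nat).
    assert (H4S : INR (4 ^ S k) = 4 * t ^ 2).
    { change (4 ^ S k)%nat with (4 * 4 ^ k)%nat. rewrite mult_INR, H4. simpl; ring. }
    rewrite H4S in Hb.
    apply Rle_trans with
      (/ (2 * t ^ 5) * (psum s (4 ^ S k) - psum s (4 ^ k)) + / (2 * t ^ 3) * (INR 3 * t ^ 2)).
    - apply Hinc. intros n Hn. unfold f, s.
      set (z := sec (INR (S n) * PI * rho)).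
      assert (HnS : t ^ 2 <= INR (S n)).
      { rewrite <- H4. apply le_INR; lia. }
      assert (Ht2 : 0 < t ^ 2) by (apply pow_lt, Ht).
      unfold Rdiv. rewrite Rabs_mult, (Rabs_pos_eq (/ _))
        by (left; apply Rinv_0_lt_compat, pow_lt; lra).
      apply Rle_trans with (Rabs z * / (t ^ 2) ^ 2).
      + apply Rmult_le_compat_l; [apply Rabs_pos|].
        apply Rinv_le_contravar; [apply pow_lt, Ht2|apply pow_incr; lra].
      + rewrite <- (pow2_abs z). set (y := Rabs z).
        apply Rminus_le_0.
        replace (/ (2 * t ^ 5) * y ^ 2 + / (2 * t ^ 3) - y * / (t ^ 2) ^ 2)
          with ((y - t) ^ 2 * / (2 * t ^ 5)) by (field; lra).
        apply Rmult_le_pos; [apply pow2_ge_0|].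
        left; apply Rinv_0_lt_compat. assert (0 < t ^ 5) by (apply pow_lt, Ht). lra.
    - apply Rle_trans with (/ (2 * t ^ 5) * (C * (4 * t ^ 2) ^ 2) + / (2 * t ^ 3) * (INR 3 * t ^ 2)).
      + apply Rplus_le_compat_r, Rmult_le_compat_l.
        * left; apply Rinv_0_lt_compat. assert (0 < t ^ 5) by (apply pow_lt, Ht). lra.
        * specialize (Hspos (4 ^ k)%nat). lra.
      + replace (/ (2 * t ^ 5) * (C * (4 * t ^ 2) ^ 2) + / (2 * t ^ 3) * (INR 3 * t ^ 2))
          with ((8 * C + 3 / 2) * / t) by (simpl (INR 3); field; lra).
        apply Rmult_le_compat_r; [|lra]. left; apply Rinv_0_lt_compat, Ht. }
  set (A := 8 * C + 2) in *.
  assert (Hpow : forall k, psum f (4 ^ k) <= psum f 1 + 2 * A - 2 * A * / 2 ^ k).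
  { induction k as [|k IH]; [simpl; lra|].
    specialize (Hblock k).
    assert (H2 : / 2 ^ S k = / 2 ^ k / 2) by (simpl; field; apply pow_nonzero; lra).
    rewrite H2. lra. }
  assert (Hmono : forall n m, (n <= m)%nat -> psum f n <= psum f m).
  { intros n m Hnm; induction Hnm as [|m Hnm IH]; [lra|]. cbn [psum].
    specialize (Hf m); lra. }
  apply ex_finite_lim_seq_incr with (M := psum f 1 + 2 * A).
  - intros n. rewrite !sum_n_psum. apply Hmono; lia.
  - intros n. rewrite sum_n_psum.
    apply Rle_trans with (psum f (4 ^ S n)).
    + apply Hmono. apply Nat.lt_le_incl, Nat.pow_gt_lin_r; lia.
    + apply Rle_trans with (1 := Hpow (S n)).
      assert (0 < / 2 ^ S n) by (apply Rinv_0_lt_compat, pow_lt; lra).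
      unfold A in *. nra.
Qed.

(** * The secant series as a solution of the functional equation *)

Definition secant_cosine_series (rho x : R) : R :=
  / (2 * PI ^ 2) * cosine_series (fun n => sec (INR (S n) * PI * rho) / INR (S n) ^ 2) x.

(** By [cos (A + B) + cos (A - B) = 2 cos A cos B], the two shifts cancel the secant and leave the
    Bernoulli series. *)
Lemma secant_cosine_series_solution (rho : R) :
  badly_approximable rho -> secant_solution 1 rho (secant_cosine_series rho).
Proof.
  intros Hba. assert (Hex := ex_series_sec rho Hba).
  assert (Hirr := badly_approximable_irrational rho Hba).
  assert (HPI := PI_RGT_0).
  set (a := fun n => sec (INR (S n) * PI * rho) / INR (S n) ^ 2) in *.
  unfold secant_cosine_series. fold a.
  split.
  - intros x. rewrite cosine_series_periodic. reflexivity.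
  - intros x Hx.
    assert (Hsum : cosine_series a (x + rho / 2) + cosine_series a (x - rho / 2)
                   = 2 * cosine_series inv_square x).
    { unfold cosine_series. rewrite <- Series_plus by (apply ex_series_cosine, Hex).
      rewrite <- Series_scal_l. apply Series_ext. intros n.
      unfold a, inv_square, sec.
      set (t := INR (S n)).
      assert (Ht : t <> 0) by (apply not_0_INR; lia).
      (* A zero of the cosine would make [2 t rho] an odd integer. *)
      assert (Hcos : cos (t * PI * rho) <> 0).
      { intros H0. apply cos_eq_0_0 in H0. destruct H0 as [k Hk].
        assert (Hk2 : 2 * (t * rho) = 2 * IZR k + 1).
        { apply Rmult_eq_reg_r with PI; [|lra]. nra. }
        apply (Hirr (2 * Z.of_nat (S n))%Z (- (2 * k + 1))%Z); [lia|].
        rewrite opp_IZR, plus_IZR, !mult_IZR, <- INR_IZR_INZ. fold t. lra. }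
      replace (2 * PI * t * (x + rho / 2)) with (2 * PI * t * x + t * PI * rho) by field.
      replace (2 * PI * t * (x - rho / 2)) with (2 * PI * t * x - t * PI * rho) by field.
      rewrite cos_plus, cos_minus. field. split; assumption. }
    rewrite <- Rmult_plus_distr_l, Hsum, inv_square_series by exact Hx.
    field. lra.
  - apply continuity_pt_mult.
    + apply continuity_pt_const; intros ? ?; reflexivity.
    + apply cosine_series_continuous, Hex.
Qed.

Lemma secant_zeta_is_series (rho : R) :
  badly_approximable rho -> secant_zeta_is rho (8 * secant_cosine_series rho 0).
Proof.
  intros Hba. assert (Hex := ex_series_sec rho Hba).
  assert (HPI := PI_RGT_0).
  unfold secant_zeta_is, secant_zeta_term, secant_cosine_series, cosine_series.
  set (a := fun n => sec (INR (S n) * PI * rho) / INR (S n) ^ 2) in *.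
  replace (Series _) with (Series a).
  2:{ apply Series_ext. intros n. rewrite Rmult_0_r, cos_0. unfold a; ring. }
  replace (8 * (/ (2 * PI ^ 2) * Series a)) with (4 / PI ^ 2 * Series a) by (field; lra).
  apply (is_series_scal (K := R_AbsRing) (V := R_NormedModule) (4 / PI ^ 2) a).
  apply Series_correct, ex_series_Rabs, Hex.
Qed.

(** * Quadratic irrationals *)

(* Descent [(m, a) -> (a - t m, t (t + 1) m - t a)]. *)
Lemma pronic_not_square (t m a : Z) :
  (0 < t)%Z -> (a * a = t * (t + 1) * (m * m))%Z -> m = 0%Z.
Proof.
  intros Ht.
  assert (Hdesc : forall (k : nat) m a, (0 <= m < Z.of_nat k)%Z -> (0 <= a)%Z ->
            (a * a = t * (t + 1) * (m * m))%Z -> m = 0%Z).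
  { clear m a. induction k as [|k IH]; intros m a Hm Ha H; [lia|].
    destruct (Z.eq_dec m 0) as [H0|H0]; [exact H0|exfalso].
    (* Since [t^2 < t (t + 1) < (t + 1)^2], the new first coordinate satisfies [0 < a - t m < m]. *)
    assert (H1 : (t * m < a)%Z) by nia.
    assert (H2 : (a < t * m + m)%Z) by nia.
    assert (H3 : (a - t * m = 0)%Z); [|lia].
    apply (IH (a - t * m)%Z (t * (t + 1) * m - t * a)%Z); [lia|nia|].
    transitivity (t * (t + 1) * (t * (t + 1) * (m * m)) - 2 * t * t * (t + 1) * m * a
                  + t * t * (a * a))%Z; [ring|].
    rewrite <- H at 1.
    transitivity (t * (t + 1) * (a * a) - 2 * t * t * (t + 1) * m * a
                  + t * t * (t * (t + 1) * (m * m)))%Z; [rewrite <- H; ring|ring]. }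
  intros H.
  assert (Hz : Z.abs m = 0%Z); [|lia].
  apply (Hdesc (S (Z.to_nat (Z.abs m))) (Z.abs m) (Z.abs a)); [lia|lia|].
  rewrite !Z.abs_square; exact H.
Qed.

(** Multiplying a zero of the form by [p] gives [(n p)^2 = t (t + 1) m^2] with [t = 2 p K]. *)
Lemma quadratic_form_nonzero (K p m n : Z) :
  (0 < K)%Z -> p <> 0%Z -> (m <> 0 \/ n <> 0)%Z ->
  (m * m * (2 * K * (2 * p * K + 1)) - n * n * p)%Z <> 0%Z.
Proof.
  intros HK Hp Hmn H.
  set (t := (2 * p * K)%Z).
  assert (Hsq : (n * p * (n * p) = t * (t + 1) * (m * m))%Z).
  { replace (n * p * (n * p))%Z with (p * (n * n * p))%Z by ring.
    replace (n * n * p)%Z with (m * m * (2 * K * (2 * p * K + 1)))%Z by lia.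
    unfold t; ring. }
  assert (Hm : m = 0%Z).
  { destruct (Z_lt_le_dec 0 t) as [Ht|Ht].
    - apply (pronic_not_square t m (n * p) Ht Hsq).
    (* The product [t (t + 1)] is invariant under [t -> - t - 1], which is positive here. *)
    - apply (pronic_not_square (- t - 1) m (n * p)).
      + unfold t in *. nia.
      + rewrite Hsq; ring. }
  subst m. assert (n * p = 0)%Z by nia. nia.
Qed.

(** Liouville's argument: [(m + n r) (m - n r) q] is a nonzero integer, and the conjugate factor is
    at most [(1 + r) (|m| + |n|)]. *)
Lemma sqrt_lattice_bound (p q : Z) (r : R) :
  q <> 0%Z -> 0 < r -> r ^ 2 = IZR p / IZR q ->
  (forall m n : Z, (m <> 0 \/ n <> 0)%Z -> (m * m * q - n * n * p)%Z <> 0%Z) ->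
  exists c, 0 < c /\ forall m n : Z, (m <> 0 \/ n <> 0)%Z ->
    c <= Rabs (IZR m + IZR n * r) * (Rabs (IZR m) + Rabs (IZR n)).
Proof.
  intros Hq Hr Hr2 Hnz.
  assert (HqR : IZR q <> 0) by (apply not_0_IZR; exact Hq).
  assert (Hqa : 0 < Rabs (IZR q)) by (apply Rabs_pos_lt, HqR).
  exists (/ (Rabs (IZR q) * (1 + r))).
  split; [apply Rinv_0_lt_compat; nra|].
  intros m n Hmn.
  assert (Hprod : Rabs (IZR m + IZR n * r) * Rabs (IZR m - IZR n * r) * Rabs (IZR q)
                  = Rabs (IZR (m * m * q - n * n * p))).
  { rewrite <- !Rabs_mult. f_equal. rewrite minus_IZR, !mult_IZR.
    replace ((IZR m + IZR n * r) * (IZR m - IZR n * r) * IZR q)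
      with (IZR m * IZR m * IZR q - IZR n * IZR n * (r ^ 2 * IZR q)) by ring.
    rewrite Hr2. field. exact HqR. }
  assert (H1 : 1 <= Rabs (IZR (m * m * q - n * n * p))).
  { rewrite <- abs_IZR. apply IZR_le. specialize (Hnz m n Hmn). lia. }
  assert (Htri : Rabs (IZR m - IZR n * r) <= (1 + r) * (Rabs (IZR m) + Rabs (IZR n))).
  { apply Rle_trans with (1 := Rabs_triang _ _).
    rewrite Rabs_Ropp, Rabs_mult, (Rabs_pos_eq r) by lra.
    assert (0 <= Rabs (IZR m)) by apply Rabs_pos.
    assert (0 <= Rabs (IZR n)) by apply Rabs_pos. nra. }
  assert (H0 := Rabs_pos (IZR m + IZR n * r)).
  assert (Hpos : 0 < Rabs (IZR q) * (1 + r)) by nra.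
  apply Rmult_le_reg_l with (Rabs (IZR q) * (1 + r)); [exact Hpos|].
  rewrite Rinv_r by lra.
  apply Rle_trans with (1 := H1). rewrite <- Hprod.
  set (A := Rabs (IZR m + IZR n * r)) in *.
  apply Rle_trans with
    (A * ((1 + r) * (Rabs (IZR m) + Rabs (IZR n))) * Rabs (IZR q)); [|lra].
  apply Rmult_le_compat_r; [lra|]. apply Rmult_le_compat_l; [exact H0|exact Htri].
Qed.

(** For [u = r / (1 + k r)], the number [n u - m] times [1 + k r] is the lattice form at
    [(- m, n - m k)]. One bound thus serves both [r] and its image. *)
Lemma lattice_badly_approximable (r c : R) (k : nat) :
  0 < r -> 0 < c ->
  (forall m n : Z, (m <> 0 \/ n <> 0)%Z ->
    c <= Rabs (IZR m + IZR n * r) * (Rabs (IZR m) + Rabs (IZR n))) ->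
  badly_approximable (r / (1 + INR k * r)).
Proof.
  intros Hr Hc H.
  assert (Hk := pos_INR k).
  set (om := 1 + INR k * r).
  assert (Hom : 1 <= om) by (unfold om; nra).
  set (u := r / om).
  assert (Hu : 0 < u) by (apply Rdiv_lt_0_compat; lra).
  set (B := 1 + (1 + INR k) * (u + 1)).
  assert (HB : 0 < B) by (unfold B; nra).
  exists (Rmin 1 (c / (om * B))).
  assert (Hc' : 0 < c / (om * B)) by (apply Rdiv_lt_0_compat; nra).
  split; [apply Rmin_pos; lra|].
  intros n m Hn.
  assert (Hn1 : 1 <= INR n) by (apply (le_INR 1); lia).
  assert (Hin : 0 < / INR n <= 1).
  { split; [apply Rinv_0_lt_compat; lra|]. rewrite <- Rinv_1.
    apply Rinv_le_contravar; lra. }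
  (* If [m] is of the order of [n], the lattice vector has size at most [B n]; otherwise the
     distance already exceeds 1. *)
  destruct (Rle_dec (Rabs (IZR m)) ((u + 1) * INR n)) as [Hm|Hm].
  - apply Rle_trans with (c / (om * B) / INR n).
    { unfold Rdiv at 1 2. apply Rmult_le_compat_r; [lra|apply Rmin_r]. }
    specialize (H (- m)%Z (Z.of_nat n - m * Z.of_nat k)%Z ltac:(lia)).
    rewrite minus_IZR, opp_IZR, mult_IZR, <- !INR_IZR_INZ, Rabs_Ropp in H.
    assert (Hrel : - IZR m + (INR n - IZR m * INR k) * r = (INR n * u - IZR m) * om)
      by (unfold u, om; field; fold om; lra).
    rewrite Hrel, Rabs_mult, (Rabs_pos_eq om) in H by lra.
    set (X := Rabs (INR n * u - IZR m)) in *.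
    assert (HX : 0 <= X) by apply Rabs_pos.
    assert (Hsize : Rabs (IZR m) + Rabs (INR n - IZR m * INR k) <= B * INR n).
    { assert (Ht := Rabs_triang (INR n) (- (IZR m * INR k))).
      rewrite Rabs_Ropp, Rabs_mult, (Rabs_pos_eq (INR n)), (Rabs_pos_eq (INR k)) in Ht by lra.
      unfold Rminus. unfold B. nra. }
    apply Rmult_le_reg_r with (om * B * INR n);
      [apply Rmult_lt_0_compat; [apply Rmult_lt_0_compat|]; lra|].
    replace (c / (om * B) / INR n * (om * B * INR n)) with c by (field; repeat split; lra).
    apply Rle_trans with (1 := H).
    replace (X * (om * B * INR n)) with (X * om * (B * INR n)) by ring.
    apply Rmult_le_compat_l; [nra|exact Hsize].
  - apply Rle_trans with 1.
    { apply Rle_trans with (1 * / INR n); [|lra].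
      unfold Rdiv at 1. apply Rmult_le_compat_r; [lra|apply Rmin_l]. }
    assert (Ht := Rabs_triang (IZR m - INR n * u) (INR n * u)).
    replace (IZR m - INR n * u + INR n * u) with (IZR m) in Ht by ring.
    rewrite (Rabs_pos_eq (INR n * u)) in Ht by nra.
    rewrite Rabs_minus_sym. nra.
Qed.

(** * The linear system for the value at sqrt (p / q) *)

Theorem theorem2p1 (K : nat) (p : Z) :
  (0 < K)%nat -> p <> 0%Z ->
  let q : Z := (2 * Z.of_nat K * (2 * p * Z.of_nat K + 1))%Z in
  secant_zeta_is (sqrt (IZR p / IZR q))
    (2 / 3 + IZR p / INR K - IZR p / IZR q).
Proof.
  intros HK Hp q.
  set (k := INR K). set (P := IZR p). set (D := 2 * P * k + 1).
  assert (Hk1 : 1 <= k) by (apply (le_INR 1); lia).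
  assert (HqR : IZR q = 2 * k * D)
    by (unfold q, D, P, k; rewrite !mult_IZR, plus_IZR, !mult_IZR, <- INR_IZR_INZ; reflexivity).
  (* [D] has the sign of [p]: this makes [p / q] positive and later fixes the sign of [nu]. *)
  assert (HPD : (1 <= P /\ 1 <= D) \/ (P <= -1 /\ D <= -1)).
  { unfold D. destruct (Z_lt_le_dec 0 p) as [H|H].
    - left. assert (1 <= P) by (apply IZR_le; lia). nra.
    - right. assert (P <= -1) by (apply IZR_le; lia). nra. }
  assert (HD : D <> 0) by lra.
  assert (Hq : q <> 0%Z) by (unfold q; nia).
  assert (Hpq : 0 < P / IZR q).
  { rewrite HqR. destruct HPD as [[H1 H2]|[H1 H2]].
    - apply Rdiv_lt_0_compat; nra.
    - replace (P / (2 * k * D)) with (- P / (2 * k * - D)) by (field; lra).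
      apply Rdiv_lt_0_compat; nra. }
  set (r := sqrt (P / IZR q)).
  assert (Hr : 0 < r) by (apply sqrt_lt_R0, Hpq).
  assert (Hr2 : r ^ 2 = P / IZR q) by (unfold r; apply pow2_sqrt; lra).
  destruct (sqrt_lattice_bound p q r Hq Hr Hr2) as (c & Hc & Hlat).
  { intros m n Hmn. apply quadratic_form_nonzero; [lia|exact Hp|exact Hmn]. }
  assert (Hbr : badly_approximable r).
  { replace r with (r / (1 + INR 0 * r)) by (simpl; field).
    apply (lattice_badly_approximable r c); assumption. }
  set (om := 1 + 2 * k * r).
  assert (Hom : 1 < om) by (unfold om; nra).
  set (u := r / om).
  assert (Hbu : badly_approximable u).
  { replace u with (r / (1 + INR (2 * K) * r))
      by (rewrite mult_INR; unfold u, om, k; simpl (INR 2); reflexivity).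
    apply (lattice_badly_approximable r c); assumption. }
  assert (Hirr := badly_approximable_irrational r Hbr).
  assert (Hiru := badly_approximable_irrational u Hbu).
  assert (Sr := secant_cosine_series_solution r Hbr).
  assert (Su := secant_cosine_series_solution u Hbu).
  set (fr := secant_cosine_series r) in *. set (fu := secant_cosine_series u) in *.
  assert (Sou := solution_scale u om fu ltac:(lra) Su).
  replace (om * u) with r in Sou by (unfold u; field; lra).
  assert (E1 := functional_equation_add K r fr _ HK Hr Hirr Sr Sou).
  cbv beta in E1. fold k in E1. fold om in E1.
  replace (0 / om) with 0 in E1 by (field; lra).
  assert (HDr : (1 - 4 * k ^ 2 * r ^ 2) * D = 1).
  { rewrite Hr2, HqR. unfold D. field. split; [fold D|]; lra. }
  assert (Hnz : 1 - 2 * k * r <> 0).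
  { intros H. replace (1 - 4 * k ^ 2 * r ^ 2) with ((1 - 2 * k * r) * om) in HDr
      by (unfold om; ring).
    rewrite H in HDr. lra. }
  (* The relation that closes the system: the two points differ by an even integer, so [fu] solves
     the equation for both steps. *)
  assert (Huv : r / (1 - 2 * k * r) = u + 2 * P).
  { apply Rminus_diag_uniq.
    replace (r / (1 - 2 * k * r) - (u + 2 * P))
      with ((4 * k * r ^ 2 - 2 * P * (1 - 4 * k ^ 2 * r ^ 2)) / ((1 - 2 * k * r) * om))
      by (unfold u, om; field; unfold om in Hom; split; lra).
    replace (4 * k * r ^ 2 - 2 * P * (1 - 4 * k ^ 2 * r ^ 2)) with 0; [field; lra|].
    rewrite Hr2, HqR. unfold D. field. split; [fold D|]; lra. }
  set (nu := 1 - 2 * k * r) in *.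
  assert (Hnuom : nu * om * D = 1) by (rewrite <- HDr; unfold nu, om; ring).
  set (v := r / nu) in *.
  (* [om - nu = 4 k r], so combining the two functional equations isolates [fr 0]. *)
  assert (E2 : om * fr 0 - nu * om * fu 0 = nu * om * (k * v / 6 + k * v ^ 3 * nu / 4)).
  { destruct HPD as [[HP1 HD1]|[HP1 HD1]].
    - assert (Hnu : 0 < nu).
      { destruct (Rle_dec nu 0) as [H|H]; [exfalso|lra].
        assert (nu * om <= 0) by nra. nra. }
      assert (Hv : 0 < v) by (apply Rdiv_lt_0_compat; lra).
      (* The map [v -> v / (1 + 2 K v)] returns to [r], so the same functional equation applies with
         base point [v]. *)
      assert (Hom' : 1 + 2 * k * v = / nu) by (unfold v, nu; field; fold nu; lra).
      assert (Hin : 0 < / nu) by (apply Rinv_0_lt_compat, Hnu).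
      assert (Sv : secant_solution 1 v fu) by (rewrite Huv; apply solution_shift, Su).
      assert (Sor := solution_scale r (/ nu) fr Hin Sr).
      replace (/ nu * r) with v in Sor by (unfold v; field; lra).
      rewrite <- Hom' in Sor.
      assert (Hirv : irrational v).
      { rewrite Huv. unfold P. replace (u + 2 * IZR p) with (IZR 1 * u + IZR (2 * p))
          by (rewrite mult_IZR; ring).
        apply irrational_affine; [lia|exact Hiru]. }
      assert (E := functional_equation_add K v fu _ HK Hv Hirv Sv Sor).
      cbv beta in E. fold k in E. rewrite Hom' in E.
      replace (0 / / nu) with 0 in E by (field; lra).
      replace (om * fr 0 - nu * om * fu 0) with (nu * om * (/ nu * fr 0 - fu 0))
        by (field; lra).
      rewrite E. field. lra.
    - assert (Hnu : nu < 0).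
      { destruct (Rlt_dec nu 0) as [H|H]; [exact H|exfalso].
        assert (0 <= nu * om) by nra. nra. }
      assert (Hu0 : 0 < u) by (apply Rdiv_lt_0_compat; lra).
      (* From [u < - v] and [u - v = - 2 p >= 2]. *)
      assert (Hv : 1 < - v).
      { assert (Hvu : u < - v).
        { unfold u, v. replace (- (r / nu)) with (r * / (- nu)) by (field; lra).
          apply Rmult_lt_compat_l; [exact Hr|].
          apply Rinv_lt_contravar; [nra|]. unfold nu, om; lra. }
        lra. }
      assert (Hom' : 2 * k * (- v) - 1 = / (- nu)) by (unfold v, nu; field; fold nu; lra).
      assert (Hin : 0 < / (- nu)) by (apply Rinv_0_lt_compat; lra).
      assert (Sv : secant_solution 1 (- v) fu)
        by (rewrite Huv; apply solution_opp, solution_shift, Su).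
      assert (Sor := solution_scale r (/ (- nu)) fr Hin Sr).
      replace (/ (- nu) * r) with (- v) in Sor by (unfold v; field; lra).
      rewrite <- Hom' in Sor.
      assert (Hirv : irrational (- v)).
      { rewrite Huv. unfold P.
        replace (- (u + 2 * IZR p)) with (IZR (-1) * u + IZR (- (2 * p)))
          by (rewrite opp_IZR, mult_IZR; ring).
        apply irrational_affine; [lia|exact Hiru]. }
      assert (E := functional_equation_sub K (- v) fu _ HK Hv Hirv Sv Sor).
      cbv beta in E. fold k in E. rewrite Hom' in E.
      replace (0 / / (- nu)) with 0 in E by (field; lra).
      replace (om * fr 0 - nu * om * fu 0) with (- (nu * om) * (fu 0 + / (- nu) * fr 0))
        by (field; lra).
      rewrite E. field. lra. }
  assert (Hgoal : 8 * fr 0 = 2 / 3 + P / k - P / IZR q).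
  { assert (HPk : P / k = 2 * r ^ 2 / (nu * om)).
    { replace (2 * r ^ 2 / (nu * om)) with (2 * r ^ 2 * D * (/ (nu * om * D)))
        by (field; repeat split; lra).
      rewrite Hnuom, Hr2, HqR. field. split; lra. }
    rewrite HPk, <- Hr2.
    apply Rmult_eq_reg_r with (4 * k * r); [|nra].
    (* Adding [nu] times [E1] to [E2] eliminates [fu 0]. *)
    assert (Ha : fr 0 * (4 * k * r)
      = nu * om * (k * v / 6 + k * v ^ 3 * nu / 4)
        + nu * (k * r / 6 + k * r ^ 3 / (4 * om))).
    { rewrite <- E1, <- E2. unfold nu, om. ring. }
    replace (8 * fr 0 * (4 * k * r)) with (8 * (fr 0 * (4 * k * r))) by ring.
    rewrite Ha. unfold v, nu, om. field. fold nu om. split; lra. }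
  rewrite <- Hgoal. apply secant_zeta_is_series, Hbr.
Qed.
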